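(* Let $A\in\mathscr{R}$. Consider the $d$-dimensional risk model described in the context, with discounted aggregate claims ${\bf D}(t)=\sum_{i=1}^{N(t)}{\bf X}^{(i)}e^{-\xi(T_i)}$, and suppose the following. (i) For every $T\in(0,\infty)$ there exist constants $C_2\ge C_1\ge 0$ (depending on $T$) such that $\mathbf{P}\left[\inf_{0\le t\le T}\xi(t)\ge -C_1\right]=1$ and $\mathbf{P}\left[\sup_{0\le t\le T}\xi(t)\le C_2\right]=1$. (ii) The claim vectors ${\bf X}^{(i)}$, $i\in\mathbb{N}$, are identically distributed with common distribution $F\in(\mathcal{D}\cap\mathcal{L})_A$, and for all $i\ne j$ the vectors ${\bf X}^{(i)},{\bf X}^{(j)}$ are tail asymptotically independent on $A$, i.e. with $Y_A^{(i)}:=\sup\{u:{\bf X}^{(i)}\in uA\}$, $$\lim_{x_i\wedge x_j\to\infty}\mathbf{P}\left[Y_A^{(i)}>x_i\,\middle|\,Y_A^{(j)}>x_j\right]=0 .$$ (iii) $\{{\bf X}^{(i)},\,i\in\mathbb{N}\}$, $\{N(t),\,t\ge0\}$, $\{\xi(t),\,t\ge0\}$ and $\{{\bf c}(t),\,t\ge0\}$ are mutually independent. Then for any fixed $T>0$, $$\mathbf{P}\left[{\bf D}(t)\in xA\right]\sim\int_0^t\mathbf{P}\left[{\bf X}\,e^{-\xi(s)}\in xA\right]\lambda(ds),\qquad x\to\infty,$$ uniformly for $t\in\Lambda_T$, where ${\bf X}$ denotes a random vector with distribution $F$, independent of $\{\xi(t),\,t\ge 0\}$.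
   Context: Risk model. Fix $d\in\mathbb{N}$. Claim vectors ${\bf X}^{(i)}=(X^{(i)}_1,\dots,X^{(i)}_d)$, $i\in\mathbb{N}$, take values in $[0,\infty)^d\setminus\{{\bf 0}\}$ (some components may be zero, but not all); the dependence among the components of each vector is arbitrary. The $i$-th claim vector arrives at time $T_i$ ($T_0=0$), where $(T_i)$ are the arrival times of a renewal counting process $\{N(t),t\ge0\}$ with finite renewal function $\lambda(t)=\mathbf{E}[N(t)]=\sum_{i\ge1}\mathbf{P}[T_i\le t]$. $\{\xi(t),t\ge0\}$ is a càdlàg stochastic process with $\xi(0)=0$ (the investment portfolio price process is $e^{\xi(t)}$). ${\bf c}(t)=(c_1(t),\dots,c_d(t))$ is the premium density, with $0\le c_i(t)\le M_i$ for all $t\ge0$ and some constants $M_i\ge0$. Time sets. $\Lambda=\{t:\lambda(t)>0\}$ and $\Lambda_T=(0,T]\cap\Lambda$. Integrals $\int_0^t\cdot\,\lambda(ds)$ are Lebesgue–Stieltjes integrals over $[0,t]$. Sets. A set $A\subset\mathbb{R}^d$ is increasing if ${\bf x}\in A$, ${\bf y}\in[0,\infty)^d$ imply ${\bf x}+{\bf y}\in A$. $\mathscr{R}$ is the family of sets $A\subsetneq\mathbb{R}^d$ that are open, increasing, with $A^c$ convex and ${\bf 0}\notin\overline{A}$. $xA=\{x{\bf a}:{\bf a}\in A\}$. Distribution classes. For ${\bf X}$ with distribution $F$ on $[0,\infty)^d$ and $A\in\mathscr{R}$, $F_A$ denotes the distribution of $Y_A=\sup\{u:{\bf X}\in uA\}$;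 its tail is $\overline{F_A}(x)=\mathbf{P}[{\bf X}\in xA]$ for $x>0$. All univariate distributions considered have infinite right endpoint (tail positive everywhere). A univariate distribution $V$ with tail $\overline V=1-V$ belongs to $\mathcal{L}$ if $\lim_{x\to\infty}\overline V(x-a)/\overline V(x)=1$ for every $a>0$, and to $\mathcal{D}$ if $\limsup_{x\to\infty}\overline V(bx)/\overline V(x)<\infty$ for every $b\in(0,1)$. $F\in(\mathcal{D}\cap\mathcal{L})_A$ means $F_A\in\mathcal{D}\cap\mathcal{L}$. Asymptotics. $f(x;t)\sim g(x;t)$ uniformly for $t\in\Delta$ means $\lim_{x\to\infty}\sup_{t\in\Delta}|f(x;t)/g(x;t)-1|=0$. *)

(* Defs.v *)
From HB Require Import structures.
From mathcomp Require Import all_boot all_order all_algebra.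
From mathcomp Require Import finmap.
From mathcomp Require Import all_classical all_reals all_analysis.

Set Implicit Arguments.
Unset Strict Implicit.
Unset Printing Implicit Defensive.

Import Order.TTheory GRing.Theory Num.Theory.
Import numFieldNormedType.Exports.

Local Open Scope classical_set_scope.
Local Open Scope ring_scope.

(* R^d with its Borel sigma-algebra. *)
Notation borel_rV R d := (g_sigma_algebraType (@open 'rV[R]_d)).

Section sets.
Context {R : realType} {d : nat}.
Implicit Types (A : set 'rV[R]_d) (v : 'rV[R]_d).

Definition nonneg_vec v := forall i, 0 <= v ord0 i.

Definition increasing_set A := forall x y, A x -> nonneg_vec y -> A (x + y).

(* The family of sets denoted by a script R in the literature. *)
Definition ruin_family A :=
  [/\ A <> setT, open A, increasing_set A,
      convex_set (~` A : set (convex_lmodType 'rV[R]_d)) &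
      ~ closure A 0].

Definition dilate (x : R) A : set 'rV[R]_d := [set x *: a | a in A].

(* Y_A = sup {u : X \in u A}, as a function of the value of X. For A in
   [ruin_family] and v nonnegative and nonzero, the set is contained in
   ]0, +oo[ and bounded above; when it is empty, [sup] is 0. *)
Definition radial_sup A v : R := sup [set u | dilate u A v].

End sets.

Section univariate_classes.
Context {R : realType}.
Implicit Types V : set R -> \bar R.

Definition tail V (x : R) : R := fine (V `]x, +oo[%classic).

Definition infinite_endpoint V := forall x, 0 < tail V x.

Definition class_L V :=
  forall a : R, 0 < a -> tail V (x - a) / tail V x @[x --> +oo] --> (1 : R).

Definition class_D V := forall b : R, 0 < b < 1 ->
  (limf_esup (fun x => (tail V (b * x) / tail V x)%:E) (pinfty_nbhs R)
     < +oo)%E.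

End univariate_classes.

(* F_A, the law of Y_A when X has law F. *)
Definition law_along {R : realType} {d : nat}
    (F : probability (borel_rV R d) R) (A : set 'rV[R]_d) : set R -> \bar R :=
  pushforward F (radial_sup A : borel_rV R d -> R).

Definition in_class_DL_along {R : realType} {d : nat}
    (F : probability (borel_rV R d) R) (A : set 'rV[R]_d) :=
  [/\ infinite_endpoint (law_along F A), class_D (law_along F A) &
      class_L (law_along F A)].

Section independence.
Context {disp} {Omega : measurableType disp} {R : realType}.
Variable P : probability Omega R.

Definition mutually_independent {I : choiceType} (S : I -> set_system Omega) :=
  forall (J : {fset I}) (E : I -> set Omega),
    (forall i, i \in J -> S i (E i)) ->
    fine (P (\bigcap_(i in [set` J]) E i)) = \prod_(i <- J) fine (P (E i)).

Definition independent_families (s : seq (set_system Omega)) :=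
  mutually_independent (fun k : 'I_(size s) => nth set0 s k).

(* The sigma-algebra generated by the random elements Z i, i in D. *)
Definition sigma_gen {I : Type} {disp'} {E : measurableType disp'}
    (D : set I) (Z : I -> Omega -> E) : set_system Omega :=
  <<s \bigcup_(i in D) preimage_set_system setT (Z i) measurable >>.

Definition has_law {disp'} {E : measurableType disp'}
    (Z : {RV P >-> E}) (F : set E -> \bar R) :=
  forall B, measurable B -> distribution P Z B = F B.

Definition cond_prob (E G : set Omega) : R := fine (P (E `&` G)) / fine (P G).

(* x /\ y --> +oo is convergence along the product filter. *)
Definition tail_asymp_indep (Y Z : Omega -> R) :=
  cond_prob [set w | z.1 < Y w] [set w | z.2 < Z w]
    @[z --> filter_prod (pinfty_nbhs R) (pinfty_nbhs R)] --> (0 : R).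

End independence.

Definition cadlag {R : realType} (f : R -> R) :=
  (forall t : R, 0 <= t -> f s @[s --> t^'+] --> f t) /\
  (forall t : R, 0 < t -> cvg (f s @[s --> t^'-])).

Section renewal.
Context {disp} {Omega : measurableType disp} {R : realType}.
Variable P : probability Omega R.

(* T_n = tau_1 + ... + tau_n, the inter-arrival times being numbered from 0:
   [tau k] is the time between the k-th and the (k+1)-st arrival. *)
Definition arrival_time (tau : nat -> {RV P >-> R}) (n : nat) (w : Omega) : R :=
  \sum_(k < n) tau k w.

(* The last clause says N(t) = sup {n : T_n <= t}. *)
Definition renewal_process (tau : nat -> {RV P >-> R})
    (N : R -> {RV P >-> nat}) :=
  [/\ forall n w, 0 <= tau n w,
      mutually_independent P
        (fun n => preimage_set_system setT (tau n) measurable),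
      forall n, has_law (tau n) (distribution P (tau 0%N)) &
      forall (t : R) w n, 0 <= t -> (n <= N t w)%N = (arrival_time tau n w <= t)].

(* lambda(t) = E[N(t)] for t >= 0, extended by 0 to the negative half-line, so
   that the Stieltjes measure of {0} is lambda(0). *)
Definition renewal_function (N : R -> {RV P >-> nat}) (t : R) : \bar R :=
  if t < 0 then 0%E else 'E_P[fun w => (N t w)%:R]%E.

End renewal.

(* D(t); [X i] is the claim of the (i+1)-st arrival. *)
Definition discounted_claims {disp} {Omega : measurableType disp}
    {R : realType} {P : probability Omega R} {d : nat}
    (X : nat -> {RV P >-> borel_rV R d}) (tau : nat -> {RV P >-> R})
    (N : R -> {RV P >-> nat}) (xi : R -> {RV P >-> R}) (t : R) (w : Omega) :
    'rV[R]_d :=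
  \sum_(i < N t w)
    expR (- xi (arrival_time tau i.+1 w) w) *: (X i w : 'rV[R]_d).

(* f(x; t) ~ g(x; t) as x --> +oo, uniformly for t in Delta. The supremum is
   that of a set of nonnegative numbers, hence 0 when Delta is empty. *)
Definition uniformly_equivalent {R : realType} (Delta : set R)
    (f g : R -> R -> R) :=
  ereal_sup (0%E |` [set `|f x t / g x t - 1|%:E | t in Delta])
    @[x --> +oo] --> 0%E.

(* Main.v *)
Require Import Defs.
From HB Require Import structures.
From mathcomp Require Import all_boot all_order all_algebra.
From mathcomp Require Import finmap.
From mathcomp Require Import all_classical all_reals all_analysis.
From mathcomp Require Import measurable_realfun.
From mathcomp Require Import ring lra zify.

Set Implicit Arguments.
Unset Strict Implicit.
Unset Printing Implicit Defensive.

Import Order.TTheory GRing.Theory Num.Theory.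
Import numFieldNormedType.Exports.

Local Open Scope classical_set_scope.
Local Open Scope ring_scope.

(** Write [rho = radial_sup A]. On the nonnegative orthant [rho] is the gauge of
the convex complement of [A]: for [x > 0] a nonnegative vector lies in [x A] exactly
when its gauge exceeds [x] ([dilate_radial]), and the gauge is positively
homogeneous, monotone ([radial_sup_le_add]) and subadditive ([radial_supD]). With
[Y_i = rho X_i] and [W_i] the log-price at the [i]-th arrival, the event that the
discounted claims are in [x A] therefore contains every event that the [i]-th claim
has occurred and [x e^{W_i} < Y_i], and is contained in the event that the sum of the
[e^{- W_i} Y_i] up to time [t] exceeds [x]. The problem becomes one-dimensional.

The integral on the right-hand side is the sum over [i] of the probabilities of these
single events, hence the expected number of them: the renewal measure is the sum of
the laws of the arrival times ([lebesgue_stieltjes_renewal]), and the independence of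
claims, arrivals and prices lets each source of randomness be integrated out
separately ([freezing1], [freezing2]). It remains to see that the union of the single
events and the event on the sum both have asymptotically this probability
([single_big_claim]). Let [Fb] be the tail of [Y_0] and [p t] the probability that
the first arrival is before [t]. The sum is at least its first term, which by the
bounds on the price and by dominated variation is at least a constant times
[Fb x * p t]; so errors that are small with respect to [Fb x * p t], uniformly in [t],
are negligible.

For the lower estimate, the first [n] events almost never occur in pairs, by tail
asymptotic independence, and Bonferroni's inequality applies ([pr_ge_total]). For the
upper estimate ([pr_le_total]), more than [n] arrivals contribute little: if a sum of
[m] terms exceeds [x] one of them exceeds [x / m], dominated variation bounds
[Fb (x / m)] by a power of [m] times [Fb x] ([doubling_poly]), and the probability
of [m] arrivals before [t] is at most [p t] times a geometric term
([pr_arrived_le], [arrived_moment_tail]). With at most [n] arrivals, either one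
discounted claim exceeds [x - L] or two claims are large ([few_claims]). The second
case is excluded by tail asymptotic independence once [L] is large, and in the first
one [x - L] may be replaced by [x] because the law is long-tailed and the discount
factors are bounded ([exceeds_shift]). *)

(** * The gauge of the complement of a ruin set *)

Section radial.
Context {R : realType} {d : nat} (A : set 'rV[R]_d).
Hypothesis A_ruin : ruin_family A.
Implicit Types (u v w : 'rV[R]_d) (x y : R).

Local Notation rho := (radial_sup A).

Lemma dilateE x v : x != 0 -> dilate x A v <-> A (x^-1 *: v).
Proof.
move=> x0; split=> [[a Aa <-]|Av]; first by rewrite scalerA mulVf// scale1r.
by exists (x^-1 *: v) => //; rewrite scalerA mulfV// scale1r.
Qed.

Lemma dilateZ x c v : 0 < c -> 0 < x -> dilate x A (c *: v) <-> dilate (x / c) A v.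
Proof.
move=> c0 x0; rewrite !dilateE ?gt_eqF ?divr_gt0//.
by rewrite scalerA invf_div mulrC.
Qed.

Lemma ruin_not0 : ~ A 0.
Proof. by case: A_ruin => _ _ _ _ n0 A0; apply: n0; exact: subset_closure. Qed.

Lemma nonneg_vecD u v : nonneg_vec u -> nonneg_vec v -> nonneg_vec (u + v).
Proof. by move=> u0 v0 i; rewrite mxE addr_ge0. Qed.

Lemma nonneg_vecZ x v : 0 <= x -> nonneg_vec v -> nonneg_vec (x *: v).
Proof. by move=> x0 v0 i; rewrite mxE mulr_ge0. Qed.

Lemma nonneg_vec_sum n (u : nat -> 'rV[R]_d) :
  (forall i, nonneg_vec (u i)) -> nonneg_vec (\sum_(i < n) u i).
Proof.
by move=> u0 i; rewrite summxE; apply: sumr_ge0 => k _; exact: u0.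
Qed.

(** Bounded because [A] keeps away from the origin. *)
Lemma dilate_ub v : has_ubound [set x | dilate x A v].
Proof.
case: A_ruin => _ _ _ _ n0.
have : nbhs (0 : 'rV[R]_d) (~` closure A).
  by apply: open_nbhs_nbhs; split => //; apply: closed_openC; exact: closed_closure.
move=> /nbhs_ballP[e /= e0 be].
exists (`|v| / e) => x [a Aa av].
have ea : e <= `|a|.
  rewrite leNgt; apply/negP => ae; apply: (be a); last exact: subset_closure.
  by rewrite -ball_normE /ball_ /= sub0r normrN.
rewrite ler_pdivlMr// -av normrZ (le_trans (ler_wpM2r (ltW e0) (ler_norm x)))//.
by rewrite ler_wpM2l.
Qed.

Lemma radial_sup_gt_ex x v : 0 <= x ->
  x < rho v <-> exists2 y, x < y & dilate y A v.
Proof.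
move=> x0; split=> [xv|[y xy yv]].
  have [E|E] := eqVneq [set y | dilate y A v] set0.
    by move: xv; rewrite /radial_sup E sup0 ltNge x0.
  have := @sup_gt _ _ x _ xv; move=> []; first exact/set0P.
  by move=> y yv xy; exists y.
by rewrite (lt_le_trans xy)//; apply: ub_le_sup => //; exact: dilate_ub.
Qed.

(** Moving outwards along a ray of the orthant adds a nonnegative vector, so an
increasing set cannot be left again. *)
Lemma dilate_le x y v : nonneg_vec v -> 0 < x -> x <= y ->
  dilate y A v -> dilate x A v.
Proof.
move=> v0 x0 xy; have y0 := lt_le_trans x0 xy.
rewrite !dilateE ?gt_eqF// => Av.
rewrite [X in A X](_ : _ = y^-1 *: v + (x^-1 - y^-1) *: v); last first.
  by rewrite -scalerDl addrC subrK.
case: A_ruin => _ _ Ainc _ _; apply: Ainc => //; apply: nonneg_vecZ => //.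
by rewrite subr_ge0 lef_pV2.
Qed.

(** The strict inequality comes from the openness of [A], which leaves room for a
slightly larger dilation. *)
Lemma dilate_radial x v : nonneg_vec v -> 0 < x ->
  dilate x A v <-> x < rho v.
Proof.
move=> v0 x0; rewrite radial_sup_gt_ex; last exact: ltW.
split=> [|[y xy]]; last by apply: dilate_le => //; exact: ltW.
case: A_ruin => _ Aop _ _ _ xv.
have /nbhs_ballP[e /= e0 be] : nbhs x [set y | A (y^-1 *: v)].
  have : {for x, continuous (fun y : R => y^-1 *: v)}.
    move=> z; apply: continuousZr_tmp; apply: inv_continuous; exact: lt0r_neq0.
  move=> /(_ A) /=; apply; apply: open_nbhs_nbhs; split => //.
  by apply/dilateE => //; rewrite gt_eqF.
have xy : x < x + e / 2 by rewrite ltrDl divr_gt0.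
exists (x + e / 2) => //; apply/dilateE; first by rewrite gt_eqF// (lt_trans x0).
apply: (be (x + e / 2)); rewrite -ball_normE /ball_ /= opprD addrA subrr sub0r.
by rewrite normrN gtr0_norm ?divr_gt0// ltr_pdivrMr// ltr_pMr// ltr1n.
Qed.

(** A negative dilation factor would give [A] a point of the negative orthant, and
monotonicity would carry it to the origin. *)
Lemma radial_sup_ge0 v : nonneg_vec v -> 0 <= rho v.
Proof.
move=> v0; rewrite leNgt; apply/negP => r0.
have [E|/set0P[x xv]] := eqVneq [set y | dilate y A v] set0.
  by move: r0; rewrite /radial_sup E sup0 ltxx.
have : x <= rho v by apply: ub_le_sup => //; exact: dilate_ub.
move=> /le_lt_trans => /(_ _ r0) x0.
case: A_ruin => _ _ Ainc _ _; apply: ruin_not0.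
move: xv => /= /dilateE -/(_ (ltr0_neq0 x0)) Axv.
rewrite -[0](subrr (x^-1 *: v)); apply: Ainc => //.
by rewrite -scaleNr; apply: nonneg_vecZ => //; rewrite oppr_ge0 invr_le0 ltW.
Qed.

Lemma radial_sup_le_add u v : nonneg_vec u -> nonneg_vec v ->
  rho u <= rho (u + v).
Proof.
move=> u0 v0; rewrite leNgt; apply/negP => /[dup] uv.
have r0 := radial_sup_ge0 (nonneg_vecD u0 v0).
have [m /andP[m1 m2]] : exists m, rho (u + v) < m < rho u.
  by exists ((rho (u + v) + rho u) / 2); rewrite !midf_lt.
have m0 := le_lt_trans r0 m1.
move/dilate_radial : m2 => /(_ u0 m0) /dilateE; rewrite gt_eqF// => /(_ isT) Au.
suff : m < rho (u + v) by move=> /lt_trans -/(_ _ m1); rewrite ltxx.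
apply/dilate_radial => //; first exact: nonneg_vecD.
apply/dilateE; first by rewrite gt_eqF.
case: A_ruin => _ _ Ainc _ _; rewrite scalerDr; apply: Ainc => //.
by apply: nonneg_vecZ => //; rewrite invr_ge0 ltW.
Qed.

(** Points just outside [x A] and [y A] scale into the complement of [A], whose
convexity puts their sum outside [(x + y) A]. *)
Lemma radial_supD u v : nonneg_vec u -> nonneg_vec v ->
  rho (u + v) <= rho u + rho v.
Proof.
move=> u0 v0; apply/ler_addgt0Pr => e e0.
set x := rho u + e / 2; set y := rho v + e / 2.
have x0 : 0 < x by rewrite ltr_wpDl ?divr_gt0 ?radial_sup_ge0.
have y0 : 0 < y by rewrite ltr_wpDl ?divr_gt0 ?radial_sup_ge0.
have -> : rho u + rho v + e = x + y by rewrite /x /y; field.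
rewrite leNgt; apply/negP => /dilate_radial -/(_ (nonneg_vecD u0 v0) (addr_gt0 x0 y0)).
have xu : ~ A (x^-1 *: u).
  move=> /dilateE -/(_ (lt0r_neq0 x0)) /dilate_radial -/(_ u0 x0).
  by rewrite ltNge lerDl divr_ge0// ltW.
have yv : ~ A (y^-1 *: v).
  move=> /dilateE -/(_ (lt0r_neq0 y0)) /dilate_radial -/(_ v0 y0).
  by rewrite ltNge lerDl divr_ge0// ltW.
move=> /dilateE -/(_ (lt0r_neq0 (addr_gt0 x0 y0))).
case: A_ruin => _ _ _ Acv _.
have xy1 : 0 <= x / (x + y) <= 1.
  have xy0 := addr_gt0 x0 y0.
  by rewrite (divr_ge0 (ltW x0) (ltW xy0))/= ler_pdivrMr// mul1r lerDl ltW.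
have /set_mem := Acv (x^-1 *: u) (y^-1 *: v) (Itv01 (andP xy1).1 (andP xy1).2)
  (mem_set xu) (mem_set yv).
apply: contra_not; congr A.
rewrite /conv/= !scalerA scalerDr; congr (_ *: _ + _ *: _).
  by rewrite mulrAC mulfV ?mul1r ?lt0r_neq0.
rewrite /unstable.onem; clear xu yv; clearbody x y; field; by rewrite !gt_eqF ?addr_gt0.
Qed.

Lemma radial_sup0 : rho 0 <= 0.
Proof.
rewrite leNgt; apply/negP => /radial_sup_gt_ex -/(_ (lexx _))[y y0].
move=> /dilateE -/(_ (lt0r_neq0 y0)); rewrite scaler0; exact: ruin_not0.
Qed.

Lemma radial_sup_gtZ x c v : nonneg_vec v -> 0 < c -> 0 < x ->
  x < rho (c *: v) <-> x / c < rho v.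
Proof.
move=> v0 c0 x0; rewrite -!dilate_radial ?divr_gt0//; first exact: dilateZ.
by apply: nonneg_vecZ => //; exact: ltW.
Qed.

Lemma radial_supZ_le c v : nonneg_vec v -> 0 < c -> rho (c *: v) <= c * rho v.
Proof.
move=> v0 c0; rewrite leNgt; apply/negP => h.
have cr0 : 0 <= c * rho v by rewrite mulr_ge0 ?radial_sup_ge0 ?ltW.
have x0 : 0 < (c * rho v + rho (c *: v)) / 2.
  by rewrite divr_gt0// ltr_wpDl// (le_lt_trans cr0).
have [+ _] := radial_sup_gtZ v0 c0 x0.
move=> /(_ (midf_lt h).2); rewrite ltr_pdivrMr// (mulrC _ c) => /lt_trans.
by move=> /(_ _ (midf_lt h).1); rewrite ltxx.
Qed.

Lemma radial_sup_sum n (u : nat -> 'rV[R]_d) : (forall i, nonneg_vec (u i)) ->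
  rho (\sum_(i < n) u i) <= \sum_(i < n) rho (u i).
Proof.
move=> u0; elim: n => [|n IH]; first by rewrite !big_ord0 radial_sup0.
rewrite !big_ord_recr/= (le_trans (radial_supD _ _))//; first exact: nonneg_vec_sum.
by rewrite lerD2r.
Qed.

Lemma radial_sup_le_sum n (u : nat -> 'rV[R]_d) i : (forall i, nonneg_vec (u i)) ->
  (i < n)%N -> rho (u i) <= rho (\sum_(j < n) u j).
Proof.
move=> u0 ni; rewrite (bigD1 (Ordinal ni))//=; apply: radial_sup_le_add => // k.
by rewrite summxE; apply: sumr_ge0 => j _; exact: u0.
Qed.

End radial.

(** * Borel measurability in finite dimension *)

Section measurable_lt.
Context {R : realType} {disp} {T : measurableType disp}.

Lemma measurable_set_lt (f g : T -> R) : measurable_fun setT f ->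
  measurable_fun setT g -> measurable [set w | f w < g w].
Proof.
move=> mf mg; have := measurable_fun_ltr mf mg.
move=> /(_ measurableT [set true]); rewrite setTI; exact.
Qed.

Lemma measurable_set_le (f g : T -> R) : measurable_fun setT f ->
  measurable_fun setT g -> measurable [set w | f w <= g w].
Proof.
move=> mf mg; have := measurable_fun_ler mf mg.
move=> /(_ measurableT [set true]); rewrite setTI; exact.
Qed.

End measurable_lt.

Section borel_rV.
Context {R : realType} {d : nat}.

Lemma measurable_open_rV (U : set 'rV[R]_d) :
  open U -> measurable (U : set (borel_rV R d)).
Proof. by move=> oU; exact: sub_sigma_algebra. Qed.

Lemma measurable_coord (i : 'I_d) :
  measurable_fun setT (fun v : borel_rV R d => (v : 'rV[R]_d) ord0 i).
Proof.
apply: (measurability _ (measurable_realfun.RGenOpens.measurableE R)) => // _ [_ [a [b ->]] <-].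
rewrite setTI; apply: measurable_open_rV.
have /continuousP : continuous (fun v : 'rV[R]_d => v ord0 i).
  exact: coord_continuous.
by apply; exact: interval_open.
Qed.

Context disp {Omega : measurableType disp}.

(** An open set is the countable union of the rational boxes it contains. *)
Lemma measurable_fun_rV (Z : Omega -> 'rV[R]_d) :
  (forall i, measurable_fun setT (fun w => Z w ord0 i)) ->
  measurable_fun setT (Z : Omega -> borel_rV R d).
Proof.
move=> mZ; apply: (@measurability _ _ Omega (borel_rV R d) setT Z (@open 'rV[R]_d) erefl) => // _ [U oU <-]; rewrite setTI.
pose box (p : rat * 'rV[rat]_d) := [set v : 'rV[R]_d |
  forall i, `|v ord0 i - ratr (p.2 ord0 i)| < ratr p.1].
rewrite (_ : Z @^-1` U = \bigcup_(p in [set p | box p `<=` U]) (Z @^-1` box p)).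
  rewrite bigcup_mkcond; apply: countable_bigcupT_measurable => // p.
  case: ifPn => // _.
  rewrite (_ : _ @^-1` _ = \bigcap_(i in [set: 'I_d])
     [set w | `|Z w ord0 i - ratr (p.2 ord0 i)| < ratr p.1]).
    apply: fin_bigcap_measurable => // i _.
    apply: measurable_set_lt => //.
    by apply: measurableT_comp => //; exact: measurable_funB.
  by apply/seteqP; split => [w h i _|w h i]; apply: h.
apply/seteqP; split => [w Uw|w [p pU] /pU//].
have /nbhs_ballP[e /= e0 be] : nbhs (Z w) U by exact: open_nbhs_nbhs.
have /rat_in_itvoo[r] : 0 < e / 2 by exact: divr_gt0.
rewrite in_itv/= => /andP[r0 re].
have qP i : exists q : rat, `|Z w ord0 i - ratr q| < ratr r.
  have /rat_in_itvoo[q] : Z w ord0 i - ratr r < Z w ord0 i + ratr r.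
    by rewrite ltrBlDr -addrA ltrDl addr_gt0.
  rewrite in_itv/= => /andP[h1 h2]; exists q; rewrite ltr_norml.
  by apply/andP; split; lra.
pose q : 'rV[rat]_d := \row_i projT1 (cid (qP i)).
have qw i : `|Z w ord0 i - ratr (q ord0 i)| < ratr r.
  by rewrite mxE; exact: projT2 (cid (qP i)).
exists (r, q) => //= v vb; apply: be; split=> // i j; rewrite (ord1 i).
rewrite /ball /= (le_lt_trans (ler_distD (ratr (q ord0 j)) _ _))//.
rewrite (_ : e = e / 2 + e / 2); last by field.
by rewrite ltrD//; [exact: lt_trans re|rewrite distrC (lt_trans _ re)//; exact: vb].
Qed.

End borel_rV.

Section radial_measurable.
Context {R : realType} {d : nat} (A : set 'rV[R]_d).
Hypothesis A_ruin : ruin_family A.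

Lemma open_dilate x : 0 < x -> open (dilate x A).
Proof.
move=> x0; case: A_ruin => _ Aop _ _ _.
have /continuousP/(_ _ Aop) : continuous (fun v : 'rV[R]_d => x^-1 *: v).
  by move=> v; apply: scaler_continuous.
congr open; apply/seteqP; split => v /=; by move/(dilateE _ _ (lt0r_neq0 x0)).
Qed.

Lemma open_radial_sup_gt x : 0 <= x -> open [set v | x < radial_sup A v].
Proof.
move=> x0.
rewrite (_ : [set _ | _] = \bigcup_(y in [set y | x < y]) dilate y A).
  by apply: bigcup_open => y /= xy; apply: open_dilate; exact: le_lt_trans xy.
apply/seteqP; split => v /=.
  by move/(radial_sup_gt_ex A_ruin _ x0) => [y]; exists y.
by case=> y xy yv; apply/(radial_sup_gt_ex A_ruin _ x0); exists y.
Qed.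

Context disp {Omega : measurableType disp}.

(** Outside the orthant [radial_sup A] may be negative, where its level sets need not
be open; truncating at [0] keeps only the open ones. *)
Lemma measurable_radial_sup_max (X : Omega -> borel_rV R d) :
  measurable_fun setT X ->
  measurable_fun setT (fun w => Num.max 0 (radial_sup A (X w))).
Proof.
move=> mX; apply: (measurability _ (RGenOInfty.measurableE R)) => // _ [_ [x ->] <-].
rewrite setTI; have [x0|x0] := leP 0 x.
  rewrite (_ : _ @^-1` _ = X @^-1` [set v | x < radial_sup A v]); last first.
    by apply/seteqP; split => w /=; rewrite in_itv/= andbT lt_max ltNge x0.
  rewrite -[X in measurable X]setTI; apply: mX => //.
  by apply: measurable_open_rV; exact: open_radial_sup_gt.
rewrite (_ : _ @^-1` _ = setT)//; apply/seteqP; split => // w _ /=.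
by rewrite in_itv/= andbT lt_max x0.
Qed.

Lemma measurable_radial_sup (X : Omega -> 'rV[R]_d) :
  measurable_fun setT (X : Omega -> borel_rV R d) -> (forall w, nonneg_vec (X w)) ->
  measurable_fun setT (fun w => radial_sup A (X w)).
Proof.
move=> mX X0; apply: eq_measurable_fun (measurable_radial_sup_max mX) => w _.
by rewrite (max_idPr (radial_sup_ge0 A_ruin (X0 w))).
Qed.

Lemma measurable_scaled_dilate (x : R) (Z : Omega -> 'rV[R]_d) : 0 < x ->
  (forall i, measurable_fun setT (fun w => Z w ord0 i)) ->
  measurable [set w | dilate x A (Z w)].
Proof.
move=> x0 mZ; have := measurable_fun_rV mZ.
move=> /(_ measurableT (dilate x A)); rewrite setTI; apply.
by apply: measurable_open_rV; exact: open_dilate.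
Qed.

Lemma measurable_nonneg_vec : measurable ([set v | nonneg_vec v] : set (borel_rV R d)).
Proof.
rewrite (_ : [set _ | _] = \bigcap_(i in [set: 'I_d])
    [set v : borel_rV R d | 0 <= (v : 'rV[R]_d) ord0 i]).
  by apply: fin_bigcap_measurable => // i _; apply: measurable_set_le => //;
     exact: measurable_coord.
by apply/seteqP; split => [v h i _|v h i]; apply: h.
Qed.

End radial_measurable.

(** * Independence and freezing *)

Section independence_of_sigma_algebras.
Context {disp} {Omega : measurableType disp} {R : realType}.
Variable P : probability Omega R.
Local Open Scope ereal_scope.

Definition indep_classes (S1 S2 : set_system Omega) :=
  forall E1 E2, S1 E1 -> S2 E2 -> P (E1 `&` E2) = P E1 * P E2.

Lemma g_sigma_sub (G : set_system Omega) :
  G `<=` measurable -> <<s G >> `<=` measurable.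
Proof. by move=> GM; apply: smallest_sub => //; exact: sigma_algebra_measurable. Qed.

(** Dynkin's lemma: for a fixed [E1] the independent events form a lambda-system. *)
Lemma indep_classes_sigma (S1 G : set_system Omega) :
  S1 `<=` measurable -> G `<=` measurable -> setI_closed G ->
  indep_classes S1 G -> indep_classes S1 <<s G >>.
Proof.
move=> mS1 mG GI iG E1 E2 SE1; have mE1 := mS1 _ SE1.
move: E2; apply: (@dynkin_induction _ (g_sigma_algebraType G)) => //.
- by rewrite setIT probability_setT mule1.
- by move=> E2; exact: iG.
- move=> S /(g_sigma_sub mG) mS SE.
  have -> : P (E1 `&` ~` S) = P E1 - P (E1 `&` S).
    by rewrite -setDE; apply: measureD => //; rewrite ltey_eq fin_num_measure.
  rewrite SE [P (~` S)]probability_setC// muleBr ?fin_num_measure//.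
  by rewrite mule1.
- move=> F mF' tF FE.
  have mF n : measurable (F n : set Omega) := g_sigma_sub mG (mF' n).
  have PU (H : (set Omega)^nat) : (forall n, measurable (H n)) ->
      trivIset setT H -> P (\bigcup_k H k) = \sum_(n <oo) P (H n).
    by move=> mH tH; apply: measure_semi_bigcup => //; exact: bigcupT_measurable.
  rewrite setI_bigcupr PU; last 2 first.
  + by move=> n; exact: measurableI.
  + exact: trivIset_setIl.
  rewrite PU//; have PE1 : P E1 \is a fin_num by exact: fin_num_measure.
  rewrite -(fineK PE1) -nneseriesZl//.
  by apply: eq_eseriesr => n _; rewrite fineK.
Qed.

Lemma mutually_independent_prod {I : choiceType} (S : I -> set_system Omega)
    (r : seq I) (E : I -> set Omega) : mutually_independent P S -> uniq r ->
  (forall i, i \in r -> S i (E i)) ->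
  fine (P (\bigcap_(i in [set` r]) E i)) = (\prod_(i <- r) fine (P (E i)))%R.
Proof.
move=> iS ur SE; have rr : [fset x in r]%fset =i r by move=> x; rewrite inE.
have := iS [fset x in r]%fset E; rewrite (perm_big r)//=; last first.
  by apply: uniq_perm => //; exact: fset_uniq.
move=> <- => [|i]; last by rewrite rr; exact: SE.
by congr (fine (P _)); apply/seteqP; split => w h i ir; apply: h; move: ir;
  rewrite /= rr.
Qed.

Lemma independent_families_prod (s : seq (set_system Omega))
    (E : 'I_(size s) -> set Omega) : independent_families P s ->
  (forall k : 'I_(size s), nth set0 s k (E k)) ->
  fine (P (\bigcap_k E k)) = (\prod_k fine (P (E k)))%R.
Proof.
move=> iS SE.
rewrite -(mutually_independent_prod iS (index_enum_uniq _) (fun k _ => SE k)).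
congr (fine (P _)); apply/seteqP; split => w h i _; apply: h => //.
by rewrite /= mem_index_enum.
Qed.

End independence_of_sigma_algebras.

(** The law of [w |-> (Z w, w)] is a product measure when the second copy of the
sample space carries only a sigma-algebra independent of [Z]; Tonelli's theorem then
integrates [Z] out separately. Using the sample space itself as the second factor
avoids building a path space for a process. *)
Section freezing.
Context {disp} {Omega : measurableType disp} {R : realType}.
Variable P : probability Omega R.
Context {disp'} {E : measurableType disp'}.
Variables (Z : {RV P >-> E}) (G : set_system Omega).
Hypothesis mG : G `<=` measurable.
Hypothesis indepZ : indep_classes P (preimage_set_system setT Z measurable) <<s G >>.
Local Open Scope ereal_scope.

Local Notation OmegaG := (g_sigma_algebraType G).

Let measurable_idG : measurable_fun [set: Omega] (id : Omega -> OmegaG).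
Proof. by move=> _ B mB; rewrite setTI preimage_id; exact: (g_sigma_sub mG). Qed.

Let idG : {mfun Omega >-> OmegaG} :=
  HB.pack (id : Omega -> OmegaG) (isMeasurableFun.Build _ _ _ _ _ measurable_idG).

Let measurable_pairG : measurable_fun [set: Omega] (fun w => (Z w, w) : E * OmegaG).
Proof. exact: measurable_fun_pair. Qed.

Let pairG : {mfun Omega >-> (E * OmegaG)%type} :=
  HB.pack (fun w => (Z w, w) : E * OmegaG)
    (isMeasurableFun.Build _ _ _ _ _ measurable_pairG).

Variable f : E * OmegaG -> \bar R.
Hypothesis mf : measurable_fun setT f.
Hypothesis f0 : forall x, 0 <= f x.

Let integral_pairG : \int[P]_w f (Z w, w) =
  \int[distribution P Z \x distribution P idG]_x f x.
Proof.
transitivity (\int[distribution P pairG]_x f x).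
  by rewrite ge0_integral_pushforward.
apply: eq_measure_integral => // B mB _.
apply/esym/product_measure_unique => // B1 B2 mB1 mB2.
rewrite /distribution /pushforward /=; apply: indepZ => //.
by exists B1 => //; rewrite setTI.
Qed.

Lemma freezing1 :
  \int[P]_w f (Z w, w) = \int[distribution P Z]_z \int[P]_w f (z, w).
Proof.
rewrite integral_pairG fubini_tonelli1//; apply: eq_integral => z _.
rewrite /fubini_F ge0_integral_pushforward//.
by apply: measurableT_comp.
Qed.

Lemma freezing2 :
  \int[P]_w f (Z w, w) = \int[P]_w \int[distribution P Z]_z f (z, w).
Proof.
rewrite integral_pairG fubini_tonelli2// ge0_integral_pushforward//.
  exact: measurable_fun_fubini_tonelli_G.
by move=> y _; apply: integral_ge0.
Qed.

Lemma measurable_frozen1 : measurable_fun setT (fun z => \int[P]_w f (z, w)).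
Proof.
have := measurable_fun_fubini_tonelli_F (m2 := distribution P idG) f mf f0.
apply: eq_measurable_fun => z _; rewrite /fubini_F ge0_integral_pushforward//.
by apply: measurableT_comp.
Qed.

End freezing.

(** * Processes at random times and generated sigma-algebras *)

Section random_time.
Context {disp} {Omega : measurableType disp} {R : realType}.

Lemma measurable_fun_set_le (f : Omega -> R) :
  (forall t, measurable [set w | f w <= t]) -> measurable_fun setT f.
Proof.
move=> mf; apply: (measurability _ (RGenOInfty.measurableE R)) => // _ [_ [x ->] <-].
rewrite setTI (_ : _ @^-1` _ = ~` [set w | f w <= x]); first exact: measurableC.
by apply/seteqP; split => w /=; rewrite in_itv/= andbT ltNge => /negP.
Qed.

(** A right-continuous process sampled at a random time is the limit of its
samples at the times rounded up to the grid of mesh [1/(n+1)]; rounding strictly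
upwards is what right-continuity can follow. *)
Lemma measurable_sample (T : Omega -> R) (xi : R -> Omega -> R) :
  measurable_fun setT T -> (forall w, 0 <= T w) ->
  (forall s, 0 <= s -> measurable_fun setT (xi s)) ->
  (forall w t, 0 <= t -> xi s w @[s --> t^'+] --> xi t w) ->
  measurable_fun setT (fun w => xi (T w) w).
Proof.
move=> mT T0 mxi rc.
pose grid (n k : nat) : R := k.+1%:R / n.+1%:R.
pose k n w := Num.truncn (T w * n.+1%:R).
have kP n w : (k n w)%:R <= T w * n.+1%:R < (k n w).+1%:R.
  by apply: truncn_itv; rewrite mulr_ge0.
apply: (@measurable_fun_cvg _ _ _ setT (fun n w => xi (grid n (k n w)) w)) => //.
  move=> n _ B mB; rewrite setTI.
  rewrite (_ : _ @^-1` _ = \bigcup_j ([set w | k n w = j] `&` (xi (grid n j) @^-1` B))).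
    apply: bigcupT_measurable => j; apply: measurableI; last first.
      by rewrite -[X in measurable X]setTI; apply: mxi => //; exact: divr_ge0.
    rewrite (_ : [set _ | _] = [set w | j%:R <= T w * n.+1%:R] `&`
        [set w | T w * n.+1%:R < j.+1%:R]).
      have mTn : measurable_fun setT (fun w => T w * n.+1%:R).
        by apply: measurable_funM.
      by apply: measurableI; [exact: measurable_set_le|exact: measurable_set_lt].
    apply/seteqP; split => [w /= <-|w /= [h1 h2]].
      by have /andP[] := kP n w.
    by apply: truncn_def; rewrite h1.
  apply/seteqP; split => [w /= h|w /= [j _ [/= kj]]]; last by rewrite kj.
  by exists (k n w).
move=> w _; have := rc w (T w) (T0 w) => /cvg_at_rightP; apply.
have gP n : T w < grid n (k n w) <= T w + n.+1%:R^-1.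
  rewrite /grid ltr_pdivlMr// ler_pdivrMr// mulrDl mulVf//.
  by have /andP[h1 ->] := kP n w; rewrite -[X in X <= _]natr1 lerD2r.
split=> [n|]; first by have /andP[] := gP n.
apply: (@squeeze_cvgr _ _ _ _ (cst (T w)) (fun n => T w + n.+1%:R^-1)).
- by near=> n; have /andP[/ltW h1 h2] := gP n; rewrite /cst h1.
- exact: cvg_cst.
- rewrite -[X in _ --> X]addr0; apply: cvgD; first exact: cvg_cst.
  exact: cvg_harmonic.
Unshelve. all: by end_near. Qed.

End random_time.

Section generated.
Context {disp} {Omega : measurableType disp} {R : realType}.
Variable P : probability Omega R.

Lemma sigma_gen_preimage {I : Type} {disp'} {E : measurableType disp'}
    (D : set I) (Z : I -> Omega -> E) i B : D i -> measurable B ->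
  sigma_gen D Z (Z i @^-1` B).
Proof.
move=> Di mB; apply: sub_sigma_algebra; exists i => //.
by exists B => //; rewrite setTI.
Qed.

Lemma sigma_gen_setT {I : Type} {disp'} {E : measurableType disp'}
    (D : set I) (Z : I -> Omega -> E) : sigma_gen D Z setT.
Proof.
have /= := @measurableT _ (g_sigma_algebraType
  (\bigcup_(i in D) preimage_set_system setT (Z i) measurable)).
exact.
Qed.

Lemma sigma_gen_setI {I : Type} {disp'} {E : measurableType disp'}
    (D : set I) (Z : I -> Omega -> E) : setI_closed (sigma_gen D Z).
Proof.
move=> A B mA mB.
have /= := @measurableI _ (g_sigma_algebraType
  (\bigcup_(i in D) preimage_set_system setT (Z i) measurable)) A B.
exact.
Qed.

Lemma sigma_gen_measurable {I : Type} {disp'} {E : measurableType disp'}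
    (D : set I) (Z : I -> Omega -> E) :
  (forall i, D i -> measurable_fun setT (Z i)) -> sigma_gen D Z `<=` measurable.
Proof.
move=> mZ; apply: g_sigma_sub => _ [i Di [B mB <-]]; exact: mZ.
Qed.

Lemma measurable_gen_family {I : Type} {disp'} {E : measurableType disp'}
    (D : set I) (Z : I -> Omega -> E) i : D i ->
  measurable_fun setT
    (Z i : g_sigma_algebraType (\bigcup_(i in D) preimage_set_system setT (Z i) measurable)
      -> E).
Proof. by move=> Di _ B mB; rewrite setTI; exact: sigma_gen_preimage. Qed.

(** A pi-system generating the join of two sigma-algebras. *)
Definition setI_class (S1 S2 : set_system Omega) : set_system Omega :=
  [set E | exists E1 E2, [/\ S1 E1, S2 E2 & E = E1 `&` E2]].

Lemma setI_class_closed S1 S2 : setI_closed S1 -> setI_closed S2 ->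
  setI_closed (setI_class S1 S2).
Proof.
move=> c1 c2 _ _ [A1 [A2 [SA1 SA2 ->]]] [B1 [B2 [SB1 SB2 ->]]].
exists (A1 `&` B1), (A2 `&` B2); split; [exact: c1|exact: c2|].
by rewrite setIACA.
Qed.

Lemma measurable_gen (G : set_system Omega) {disp'} {E : measurableType disp'}
    (Z : Omega -> E) :
  (forall B, measurable B -> <<s G >> (Z @^-1` B)) ->
  measurable_fun setT (Z : g_sigma_algebraType G -> E).
Proof. by move=> h _ B mB; rewrite setTI; exact: h. Qed.

Local Open Scope ereal_scope.

(** Given [G], the level [V] is a constant and only the tail of [Z] is seen. *)
Lemma freezing_tail (Z : {RV P >-> R}) (G : set_system Omega)
    (V : Omega -> R) (C : set Omega) :
  G `<=` measurable ->
  indep_classes P (preimage_set_system setT Z measurable) <<s G >> ->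
  measurable_fun setT (V : g_sigma_algebraType G -> R) -> <<s G >> C ->
  P (C `&` [set w | (V w < Z w)%R]) =
  \int[P]_w ((\1_C w)%:E * P [set w' | (V w < Z w')%R]).
Proof.
move=> mG iZ mV GC.
pose B : set (R * g_sigma_algebraType G) := [set x | C x.2 /\ (V x.2 < x.1)%R].
have mB : measurable B.
  have -> : B = (snd @^-1` C) `&` [set x | (V x.2 < x.1)%R] by [].
  apply: measurableI.
    have := @measurable_snd _ _ R (g_sigma_algebraType G).
    by move=> /(_ measurableT C GC); rewrite setTI.
  have m1 := @measurable_fst _ _ R (g_sigma_algebraType G).
  have m2 := @measurable_snd _ _ R (g_sigma_algebraType G).
  exact: (measurable_set_lt (measurableT_comp mV m2) m1).
have mE : measurable (C `&` [set w | (V w < Z w)%R]).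
  apply: measurableI; first exact: (g_sigma_sub mG).
  apply: measurable_set_lt => //.
  by move=> _ A mA; apply: (g_sigma_sub mG); rewrite -/(g_sigma_algebraType G); exact: mV.
have := @freezing2 _ _ _ P _ _ Z G mG iZ (EFin \o \1_B).
have mf : measurable_fun setT (EFin \o \1_B : R * g_sigma_algebraType G -> \bar R).
  by apply/measurable_EFinP; exact: measurable_indic.
move=> /(_ mf) h; have {}h := h (fun x => ltac:(by rewrite lee_fin)).
have -> : P (C `&` [set w | (V w < Z w)%R]) = \int[P]_w (\1_B (Z w, w))%:E.
  rewrite (eq_integral (fun w => (\1_(C `&` [set w | (V w < Z w)%R]) w)%:E)).
    by rewrite integral_indic// setIT.
  by move=> w _; rewrite !indicE; congr ((nat_of_bool _)%:R%:E);
   apply/idP/idP => /set_mem h'; apply/mem_set.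
rewrite h; apply: eq_integral => w _.
transitivity (\int[distribution P Z]_z ((\1_C w)%:E * (\1_(`]V w, +oo[%classic) z)%:E)).
  apply: eq_integral => z _; rewrite -EFinM !indicE -natrM mulnb.
  congr ((nat_of_bool _)%:R%:E); apply/idP/idP => [/set_mem[/= h1 h2]|/andP[/set_mem h1 /set_mem]].
    by apply/andP; split; apply/mem_set => //=; rewrite in_itv/= h2.
  by rewrite /= in_itv/= andbT => h2; exact/mem_set.
have mI : measurable_fun setT (fun z : R => (\1_(`]V w, +oo[%classic) z)%:E : \bar R).
  by apply/measurable_EFinP; exact: measurable_indic.
rewrite ge0_integralZl//; congr (_ * _); rewrite integral_indic// setIT /distribution /pushforward.
by congr (P _); apply/seteqP; split => w' /=; rewrite in_itv/= andbT.
Qed.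

End generated.

(** * Probability inequalities *)

Section real_probability.
Context {disp} {Omega : measurableType disp} {R : realType}.
Variable P : probability Omega R.

Definition pr (E : set Omega) : R := fine (P E).

Lemma prK E : measurable E -> (pr E)%:E = P E.
Proof. by move=> mE; rewrite fineK// fin_num_measure. Qed.

Lemma pr_ge0 E : measurable E -> 0 <= pr E.
Proof. by move=> mE; exact: fine_ge0. Qed.

Lemma pr_le E F : measurable E -> measurable F -> E `<=` F -> pr E <= pr F.
Proof.
by move=> mE mF EF; rewrite -lee_fin !prK//; apply: le_measure; rewrite ?inE.
Qed.

Lemma pr_le1 E : measurable E -> pr E <= 1.
Proof. by move=> mE; rewrite -lee_fin prK// probability_le1. Qed.

Lemma pr_setU E F : measurable E -> measurable F -> pr (E `|` F) <= pr E + pr F.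
Proof.
move=> mE mF; rewrite -lee_fin EFinD !prK//; last exact: measurableU.
exact: measureU2.
Qed.

Lemma pr_setUI E F : measurable E -> measurable F ->
  pr (E `|` F) = pr E + pr F - pr (E `&` F).
Proof.
move=> mE mF; apply: EFin_inj; rewrite EFinB EFinD !prK//.
- by apply: measureUfinl => //; rewrite ltey_eq fin_num_measure.
- exact: measurableI.
- exact: measurableU.
Qed.

Lemma pr_bigsetU n (E : nat -> set Omega) : (forall i, measurable (E i)) ->
  pr (\big[setU/set0]_(i < n) E i) <= \sum_(i < n) pr (E i).
Proof.
move=> mE; elim: n => [|n IH]; first by rewrite !big_ord0 /pr measure0.
rewrite !big_ord_recr/= (le_trans (pr_setU _ _))//.
  exact: bigsetU_measurable.
by rewrite lerD2r.
Qed.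

(** Bonferroni: each new event meets the union of the [k] former ones in probability
at most [k * e], and these losses add up to at most [n ^ 2 * e]. *)
Lemma pr_bigsetU_ge n (E : nat -> set Omega) (e : R) :
  (forall i, measurable (E i)) ->
  0 <= e -> (forall i j, (i < j < n)%N -> pr (E i `&` E j) <= e) ->
  \sum_(i < n) pr (E i) - (n ^ 2)%:R * e <= pr (\big[setU/set0]_(i < n) E i).
Proof.
move=> mE e0; elim: n => [|n IH] ije; first by rewrite !big_ord0 mul0r subr0 /pr measure0.
rewrite !big_ord_recr/= pr_setUI//; last exact: bigsetU_measurable.
have {}IH := IH (fun i j ij => ije i j (ltac:(move: ij; lia))).
have : pr (\big[setU/set0]_(i < n) E i `&` E n) <= n%:R * e.
  rewrite setIC big_distrr/=.
  have mI i : measurable (E n `&` E i) by exact: measurableI.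
  apply: (le_trans (pr_bigsetU n mI)).
  rewrite -(card_ord n) mulr_natl -sumr_const card_ord; apply: ler_sum => i _.
  by rewrite setIC; apply: ije; rewrite ltn_ord/=.
have -> : (n.+1 ^ 2)%:R = (n ^ 2)%:R + 2 * n%:R + 1 :> R.
  have -> : (n.+1 ^ 2 = n ^ 2 + 2 * n + 1)%N by rewrite -!mulnn; lia.
  by rewrite (natrD _ (n ^ 2 + 2 * n)%N 1%N) (natrD _ (n ^ 2)%N (2 * n)%N) natrM.
have := mulr_ge0 (ler0n R n) e0.
lra.
Qed.

Lemma pr_bigcup_le n0 (E : nat -> set Omega) (F : set Omega) (e : R) :
  (forall i, measurable (E i)) -> measurable F ->
  F `<=` \bigcup_(i in [set i | (n0 <= i)%N]) E i ->
  (forall N, \sum_(n0 <= i < N) pr (E i) <= e) -> pr F <= e.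
Proof.
move=> mE mF FE Ee; rewrite -lee_fin prK//.
apply: (@le_trans _ _ (\sum_(n0 <= n <oo) P (E n))%E).
  apply: measure_sigma_subadditive_tail => //.
  by move=> w /FE[i /= n0i Ei]; exists i => //=; apply/negP; rewrite -leqNgt.
apply: lime_le; first exact: is_cvg_nneseries.
apply: nearW => N; have := Ee N; rewrite -lee_fin => /(le_trans _); apply.
by rewrite -sumEFin; apply: lee_sum => i _; rewrite prK.
Qed.

End real_probability.

Section geometric_decay.
Context {R : realType}.

Lemma exprn_le_expR (q m : nat) (a : R) : 0 < a ->
  (m%:R : R) ^+ q.+1 <= q.+1`!%:R / a ^+ q.+1 * expR (a * m%:R).
Proof.
move=> a0; have := @expR_ge1Dxn R (a * m%:R) q (mulr_ge0 (ltW a0) (ler0n _ _)).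
move=> h; have {}h : (a * m%:R) ^+ q.+1 / q.+1`!%:R <= expR (a * m%:R).
  by apply: le_trans h; rewrite lerDr.
rewrite -mulrA mulrCA ler_pdivlMl ?exprn_gt0// -exprMn.
rewrite ler_pdivrMr ?ltr0n ?fact_gt0// in h.
by rewrite [leRHS]mulrC.
Qed.

Lemma geometric_tail_le (C y : R) (n N : nat) : 0 <= C -> 0 < y < 1 ->
  \sum_(n <= m < N) C * y ^+ m <= C * y ^+ n / (1 - y).
Proof.
move=> C0 /andP[y0 y1]; have y1' : 0 < 1 - y by rewrite subr_gt0.
rewrite -mulr_sumr -mulrA ler_wpM2l// ler_pdivlMr//.
have [nN|Nn] := leqP n N; last first.
  by rewrite big_geq ?(ltnW Nn)// mul0r exprn_ge0// ltW.
rewrite -(subnKC nN) geometric_partial_tail geometric_seriesE ?lt_eqF//.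
rewrite /= divfK ?gt_eqF// ger_pMr ?exprn_gt0// gerBl exprn_ge0//; exact: ltW.
Qed.

(** An exponential decay, even along blocks of length [K], beats any power. *)
Lemma block_geometric_decay (q0 : R) (K q : nat) (e : R) :
  0 <= q0 < 1 -> (0 < K)%N -> 0 < e ->
  exists n0, forall n N, (n0 <= n)%N ->
    \sum_(n <= m < N) (m.+1%:R ^+ q.+1 * q0 ^+ (m %/ K)) <= e.
Proof.
move=> /andP[q00 q01] K0 e0.
pose r := Num.max q0 (1/2).
have r01 : 0 < r < 1 by rewrite /r lt_max gt_max q01; apply/andP; split; lra.
have [r0 r1] := andP r01.
have [s rE] := expR_total r0.
have s0 : s < 0 by rewrite -expR_lt1 rE.
(* [q0 ^+ (m %/ K)] is at most of order [expR (- 2 * a * m)]: half of the rate absorbs the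
power of [m], the other half is left for the geometric bound. *)
pose a := - s / (2 * K%:R).
have KR : 0 < K%:R :> R by rewrite ltr0n.
have a0 : 0 < a by rewrite divr_gt0 ?oppr_gt0// mulr_gt0.
pose y := expR (- a).
have y01 : 0 < y < 1 by rewrite expR_gt0 expR_lt1 oppr_lt0.
pose C := q.+1`!%:R / a ^+ q.+1 * expR a / r.
have C0 : 0 <= C by rewrite !mulr_ge0 ?invr_ge0 ?exprn_ge0 ?expR_ge0// ltW.
have key m : m.+1%:R ^+ q.+1 * q0 ^+ (m %/ K) <= C * y ^+ m.
  have h1 : q0 ^+ (m %/ K) <= expR (- (2 * a * m%:R)) / r.
    apply: (@le_trans _ _ (r ^+ (m %/ K))).
      by apply: lerXn2r; rewrite ?nnegrE ?(ltW r0)// /r le_max lexx.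
    rewrite ler_pdivlMr// -exprSr -rE -expRM_natl ler_expR.
    have : m%:R <= K%:R * (m %/ K).+1%:R :> R.
      by rewrite -natrM ler_nat mulnC mulSn {1}(divn_eq m K) addnC leq_add2r ltnW ?ltn_pmod.
    have -> : - (2 * a * m%:R) = s * m%:R / K%:R by rewrite /a; field; rewrite gt_eqF.
    rewrite -(ler_nM2l s0) ler_pdivlMr// => /(le_trans _); apply.
    by rewrite le_eqVlt; apply/orP; left; apply/eqP; ring.
  have h2 := exprn_le_expR q m.+1 a0.
  apply: (le_trans (ler_pM _ _ h2 h1)); rewrite ?exprn_ge0//.
  have uv := expRxMexpNx_1 (a * m%:R).
  have -> : expR (- (2 * a * m%:R)) = expR (- (a * m%:R)) * expR (- (a * m%:R)).
    by rewrite -expRD; congr expR; ring.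
  have -> : expR (a * m.+1%:R) = expR (a * m%:R) * expR a.
    by rewrite -natr1 mulrDr expRD mulr1.
  have -> : y ^+ m = expR (- (a * m%:R)) by rewrite /y -expRM_natr mulNr.
  rewrite /C; move: uv; move: (expR (a * _)) (expR (- (a * _))) (expR a) => u v w uv.
  move: (_ / a ^+ _) (r^-1) => b r'.
  have -> : b * (u * w) * (v * v * r') = b * w * r' * (u * v * v) by ring.
  by rewrite uv mul1r.
have ycvg : (C * y ^+ n / (1 - y)) @[n --> \oo] --> 0.
  have -> : 0 = C * 0 / (1 - y) :> R by rewrite mulr0 mul0r.
  apply: cvgMl; apply: cvgMr; apply: cvg_expr.
  by case/andP: y01 => y0 y1; rewrite gtr0_norm.
have /cvgrPdist_le /(_ _ e0)[n0 _ h] := ycvg.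
exists n0 => n N n0n; apply: (@le_trans _ _ (\sum_(n <= m < N) C * y ^+ m)).
  by apply: ler_sum.
apply: (le_trans (geometric_tail_le _ _ C0 y01)).
by have := h n n0n; rewrite sub0r normrN => /(le_trans (ler_norm _)).
Qed.

End geometric_decay.

Section null_sets.
Context {disp} {Omega : measurableType disp} {R : realType}.
Variable P : probability Omega R.

Lemma probability_bigcup0 (B : (set Omega)^nat) : (forall n, measurable (B n)) ->
  (forall n, P (B n) = 0%E) -> P (\bigcup_n B n) = 0%E.
Proof.
move=> mB B0; apply/eqP; rewrite eq_le measure_ge0 andbT.
have := @measure_sigma_subadditive _ _ _ P _ _ mB (bigcupT_measurable _ mB) (@subset_refl _ _).
move=> /le_trans; apply; rewrite eseries0// => k _ _; exact: B0.
Qed.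

End null_sets.

Section almost_sure.
Context {disp} {Omega : measurableType disp} {R : realType}.
Variable P : probability Omega R.

Lemma eq_probability_ae (Z E F : set Omega) : measurable Z -> P Z = 0%E ->
  measurable E -> measurable F -> (forall w, ~ Z w -> E w <-> F w) -> P E = P F.
Proof.
move=> mZ Z0 mE mF EF.
have PD H : measurable H -> P H = P (H `\` Z).
  move=> mH; apply/eqP; rewrite eq_le; apply/andP; split; last first.
    by apply: le_measure; rewrite ?inE//; exact: measurableD.
  apply: (@le_trans _ _ (P ((H `\` Z) `|` Z))).
    apply: le_measure; rewrite ?inE//; first by apply: measurableU => //; exact: measurableD.
    by move=> w Hw; have [Zw|Zw] := pselect (Z w); [right|left].
  by rewrite -[leRHS]adde0 -Z0; apply: measureU2 => //; exact: measurableD.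
rewrite (PD _ mE) (PD _ mF); congr (P _); apply/seteqP.
by split => w [Hw Zw]; split => //; apply/(EF w Zw).
Qed.

End almost_sure.

Section independent_families_of_classes.
Context {disp} {Omega : measurableType disp} {R : realType}.
Variable P : probability Omega R.

Lemma indep_of_families2 (S0 S1 : set_system Omega) :
  S0 `<=` measurable -> S1 `<=` measurable ->
  independent_families P [:: S0; S1] -> indep_classes P S0 S1.
Proof.
move=> m0 m1 iS E0 E1 SE0 SE1.
have mE0 := m0 _ SE0; have mE1 := m1 _ SE1.
have := @independent_families_prod _ _ _ P [:: S0; S1]
  (fun k : 'I_2 => nth set0 [:: E0; E1] k) iS.
have H (k : 'I_2) : nth set0 [:: S0; S1] k (nth set0 [:: E0; E1] k).
  by case: k => [[|[|?]]].
move=> /(_ H); rewrite !big_ord_recl big_ord0 /= mulr1.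
have -> : \bigcap_(k in [set: 'I_2]) nth set0 [:: E0; E1] k = E0 `&` E1.
  apply/seteqP; split => [w h|w [h0 h1] [[|[|?]]]//].
  by split; [exact: (h (@Ordinal 2 0 isT))|exact: (h (@Ordinal 2 1 isT))].
move=> e; rewrite -[LHS]prK; last exact: measurableI.
by rewrite -!prK// -EFinM; congr EFin.
Qed.

Lemma indep_of_families4 (S0 S1 S2 S3 : set_system Omega) :
  [/\ S0 `<=` measurable, S1 `<=` measurable & S2 `<=` measurable] -> S3 setT ->
  independent_families P [:: S0; S1; S2; S3] ->
  forall E0 E1 E2, S0 E0 -> S1 E1 -> S2 E2 ->
  P (E0 `&` (E1 `&` E2)) = (P E0 * (P E1 * P E2))%E.
Proof.
move=> [m0 m1 m2] S3T iS E0 E1 E2 SE0 SE1 SE2.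
have mE0 := m0 _ SE0; have mE1 := m1 _ SE1; have mE2 := m2 _ SE2.
have := @independent_families_prod _ _ _ P [:: S0; S1; S2; S3]
  (fun k : 'I_4 => nth set0 [:: E0; E1; E2; setT] k) iS.
have H (k : 'I_4) : nth set0 [:: S0; S1; S2; S3] k (nth set0 [:: E0; E1; E2; setT] k).
  by case: k => [[|[|[|[|?]]]]].
move=> /(_ H); rewrite !big_ord_recl big_ord0 /= mulr1.
have -> : \bigcap_(k in [set: 'I_4]) nth set0 [:: E0; E1; E2; setT] k =
    E0 `&` (E1 `&` E2).
  apply/seteqP; split => [w h|w [h0 [h1 h2]] [[|[|[|[|?]]]]]//].
  split; first exact: (h (@Ordinal 4 0 isT)).
  by split; [exact: (h (@Ordinal 4 1 isT))|exact: (h (@Ordinal 4 2 isT))].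
rewrite [in fine (P setT)]probability_setT /= mulr1 => e.
rewrite -[LHS]prK; last by do 2 apply: measurableI => //.
by rewrite -!prK// -!EFinM; congr EFin.
Qed.

End independent_families_of_classes.

(** * Renewal processes *)

Section renewal_theory.
Context {disp} {Omega : measurableType disp} {R : realType}.
Variable P : probability Omega R.
Variables (tau : nat -> {RV P >-> R}) (N : R -> {RV P >-> nat}).
Hypothesis N_renewal : renewal_process tau N.

Local Notation T n w := (arrival_time tau n w).

Lemma tau_ge0 n w : 0 <= tau n w. Proof. by case: N_renewal. Qed.

Lemma count_geE t w n : 0 <= t -> (n <= N t w)%N = (T n w <= t).
Proof. by case: N_renewal => _ _ _; apply. Qed.

Lemma arrival_timeS n w : T n.+1 w = T n w + tau n w.
Proof. by rewrite /arrival_time big_ord_recr. Qed.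

Lemma arrival_time0 w : T 0 w = 0. Proof. by rewrite /arrival_time big_ord0. Qed.

Lemma arrival_time_le m n w : (m <= n)%N -> T m w <= T n w.
Proof.
move=> /subnKC <-; elim: (n - m)%N => [|k IH]; first by rewrite addn0.
by rewrite addnS arrival_timeS (le_trans IH)// lerDl tau_ge0.
Qed.

Lemma arrival_time_ge0 n w : 0 <= T n w.
Proof. by rewrite -(arrival_time0 w) arrival_time_le. Qed.

Lemma measurable_arrival_time n : measurable_fun setT (fun w => T n w).
Proof.
elim: n => [|n IH].
  by rewrite (_ : (fun _ => _) = cst 0)//; apply/funext => w; rewrite arrival_time0.
rewrite (_ : (fun _ => _) = (fun w => T n w) \+ tau n); first exact: measurable_funD.
by apply/funext => w; rewrite arrival_timeS.
Qed.

Lemma measurable_arrived n t : measurable [set w | T n w <= t].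
Proof. by apply: measurable_set_le => //; exact: measurable_arrival_time. Qed.

Lemma arrived_lt0 n t : t < 0 -> [set w | T n w <= t] = set0.
Proof.
move=> t0; apply/seteqP; split => w //=.
by rewrite leNgt (lt_le_trans t0)// arrival_time_ge0.
Qed.

Lemma sigma_gen_arrived n t : sigma_gen `[0, +oo[ N [set w | T n w <= t].
Proof.
have [t0|t0] := leP 0 t; last first.
  have -> : [set w | T n w <= t] = N 0 @^-1` set0 by rewrite arrived_lt0// preimage_set0.
  by apply: sigma_gen_preimage => //=; rewrite in_itv/= lexx.
have -> : [set w | T n w <= t] = N t @^-1` [set k | (n <= k)%N].
  by apply/seteqP; split => w /=; rewrite count_geE.
by apply: sigma_gen_preimage => //=; rewrite in_itv/= t0.
Qed.

Lemma pr_tau_le n x : pr P [set w | tau n w <= x] = pr P [set w | tau 0 w <= x].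
Proof.
case: N_renewal => _ _ h _; have := h n `]-oo, x]%classic (measurable_itv _).
rewrite /distribution /pushforward /pr.
have E k : tau k @^-1` `]-oo, x]%classic = [set w | tau k w <= x].
  by apply/seteqP; split => w; rewrite /= in_itv.
by rewrite !E => ->.
Qed.

Lemma measurable_tau_le n x : measurable [set w | tau n w <= x].
Proof. exact: measurable_set_le. Qed.

(** Inter-arrival times that vanished almost surely would put infinitely many
arrivals at the origin. *)
Lemma tau_nondegenerate : exists2 delta, 0 < delta &
  pr P [set w | tau 0 w <= delta] < 1.
Proof.
apply: contrapT => h.
have {}h k n : P (~` [set w | tau n w <= k.+1%:R^-1]) = 0%E.
  rewrite probability_setC//; last exact: measurable_tau_le.
  rewrite -prK; last exact: measurable_tau_le.
  rewrite pr_tau_le; have [lt1|ge1] := ltP (pr P [set w | tau 0 w <= k.+1%:R^-1]) 1.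
    by exfalso; apply: h; exists k.+1%:R^-1.
  have -> : pr P [set w | tau 0 w <= k.+1%:R^-1] = 1.
    by apply/eqP; rewrite eq_le ge1 pr_le1//; exact: measurable_tau_le.
  by rewrite -EFinB subrr.
have mC k n : measurable (~` [set w | tau n w <= k.+1%:R^-1]).
  by apply: measurableC; exact: measurable_tau_le.
pose B n := \bigcup_k ~` [set w | tau n w <= k.+1%:R^-1].
have B0 n : P (B n) = 0%E by exact: probability_bigcup0.
have mB n : measurable (B n) by exact: bigcupT_measurable.
have BU0 : P (\bigcup_n B n) = 0%E by exact: probability_bigcup0.
have [E|/set0P[w wB]] := eqVneq (~` \bigcup_n B n) set0.
  have : P setT = 0%E by rewrite -setC0 -E setCK.
  by rewrite probability_setT => /eqP; rewrite onee_eq0.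
have tw n : tau n w <= 0.
  apply/ler_addgt0Pr => e e0; rewrite add0r.
  have [k ke] : exists k, k.+1%:R^-1 < e.
    by exists (Num.truncn e^-1); rewrite invf_plt ?posrE ?ltr0n// truncnS_gt.
  rewrite (le_trans _ (ltW ke))// leNgt; apply/negP => lt; apply: wB.
  by exists n => //; exists k => //=; apply/negP; rewrite -ltNge.
have T0 n : T n w <= 0.
  by rewrite /arrival_time; apply: sumr_le0 => i _; exact: tw.
by have := count_geE w (N 0 w).+1 (lexx 0); rewrite T0 ltnn.
Qed.

(** Otherwise each of [K] consecutive blocks would last longer than [delta]. The
blocks start after the first inter-arrival time, whose smallness must be kept as a
separate independent factor. *)
Lemma short_block (delta t : R) K m n w : 0 <= delta -> t < K%:R * delta ->
  (K * m <= n)%N -> T n.+1 w <= t ->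
  exists2 j, (j < K)%N & forall l, (l < m)%N -> tau (1 + j * m + l)%N w <= delta.
Proof.
move=> d0 tK Kmn Tt; apply: contrapT => h.
have {}h j : (j < K)%N -> exists2 l, (l < m)%N & delta < tau (1 + j * m + l)%N w.
  move=> jK; apply: contrapT => h'; apply: h; exists j => // l lm.
  by rewrite leNgt; apply/negP => ?; apply: h'; exists l.
have : forall k, (k <= K)%N -> k%:R * delta <= T (1 + k * m)%N w.
  elim=> [_|k IH kK]; first by rewrite mul0r arrival_time_ge0.
  have [l lm dl] := h k kK; rewrite -natr1 mulrDl mul1r.
  rewrite (@le_trans _ _ (T (1 + k * m + l).+1 w))//.
    rewrite arrival_timeS lerD ?(ltW dl)//.
    by rewrite (le_trans (IH (ltnW kK)))// arrival_time_le// leq_addr.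
  by rewrite arrival_time_le//; lia.
move=> /(_ K (leqnn _)); apply/negP; rewrite -ltNge.
by rewrite (le_lt_trans _ tK)// (le_trans _ Tt)// arrival_time_le//; lia.
Qed.

(** A union bound over the block of [short_block]: a block of short times has
geometrically small probability and is independent of the first arrival. *)
Lemma pr_arrived_le (delta t : R) K n : 0 <= delta -> t < K%:R * delta ->
  pr P [set w | T n.+1 w <= t] <=
  K%:R * pr P [set w | tau 0 w <= delta] ^+ (n %/ K) * pr P [set w | T 1 w <= t].
Proof.
move=> d0 tK; set m := (n %/ K)%N; set q := pr P [set w | tau 0 w <= delta].
pose E (k : nat) : set Omega := if k == 0%N then [set w | tau 0 w <= t]
  else [set w | tau k w <= delta].
pose r j := 0%N :: iota (1 + j * m) m.
have mE k : measurable (E k).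
  by rewrite /E; case: ifP => _; exact: measurable_tau_le.
have mB j : measurable (\bigcap_(k in [set` r j]) E k).
  by apply: fin_bigcap_measurable.
have T1 : [set w | T 1 w <= t] = [set w | tau 0 w <= t].
  by apply/seteqP; split => w /=; rewrite arrival_timeS arrival_time0 add0r.
have BE j : pr P (\bigcap_(k in [set` r j]) E k) = pr P [set w | T 1 w <= t] * q ^+ m.
  case: N_renewal => _ iS _ _; rewrite /pr (mutually_independent_prod iS).
  - rewrite big_cons {1}/E/= T1; congr (_ * _).
    rewrite big_seq (eq_bigr (fun=> q)); last first.
      move=> k; rewrite mem_iota => /andP[k0 _].
      rewrite /E; case: ifPn => [/eqP k00|_]; first by rewrite k00 in k0.
      exact: pr_tau_le.
    by rewrite -big_seq big_const_seq count_predT size_iota iter_mulr_1.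
  - by rewrite /= iota_uniq andbT mem_iota.
  - move=> k _; rewrite /E; case: ifP => [/eqP ->|_].
      exists `]-oo, t]%classic => //; rewrite setTI.
      by apply/seteqP; split => w; rewrite /= in_itv.
    exists `]-oo, delta]%classic => //; rewrite setTI.
    by apply/seteqP; split => w; rewrite /= in_itv.
apply: (@le_trans _ _ (pr P (\big[setU/set0]_(j < K) \bigcap_(k in [set` r j]) E k))).
  apply: pr_le; [exact: measurable_arrived|exact: bigsetU_measurable|].
  move=> w /= Tt.
  have Kmn : (K * m <= n)%N by rewrite mulnC leq_divM.
  have [j jK jl] := short_block d0 tK Kmn Tt.
  suff : (\bigcup_(j < K) \bigcap_(k in [set` r j]) E k) w by rewrite bigcup_mkord.
  exists j => // k /=; rewrite in_cons mem_iota /E.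
  case: ifPn => [_ _ /=|k0 /=].
    rewrite (le_trans _ Tt)// (le_trans _ (arrival_time_le w (ltn0Sn n)))//.
    by rewrite arrival_timeS arrival_time0 add0r.
  move=> /andP[k1 k2]; have := jl (k - (1 + j * m))%N.
  by rewrite subnKC//; apply; lia.
rewrite (le_trans (pr_bigsetU P K mB))//.
rewrite (eq_bigr (fun=> pr P [set w | T 1 w <= t] * q ^+ m)) => [|i _]; last exact: BE.
by rewrite sumr_const card_ord -[leLHS]mulr_natl mulrA mulrAC.
Qed.

(** Every term carries the factor [P(T_1 <= t)], which keeps the bound meaningful for
horizons [t] at which an arrival is itself unlikely. *)
Lemma arrived_moment_tail (T0 : R) (q : nat) (e : R) : 0 < e ->
  exists n0, forall t n M, t <= T0 -> (n0 <= n)%N ->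
    \sum_(n <= m < M) (m.+1%:R ^+ q.+1 * pr P [set w | T m.+1 w <= t]) <=
    e * pr P [set w | T 1 w <= t].
Proof.
move=> e0; have [delta d0 q1] := tau_nondegenerate.
set q0 := pr P _ in q1.
pose K := (Num.truncn (T0 / delta)).+1.
have TK : T0 < K%:R * delta by rewrite -ltr_pdivrMr// truncnS_gt.
have KR : 0 < K%:R :> R by rewrite ltr0n.
have q001 : 0 <= q0 < 1.
  by rewrite q1 andbT pr_ge0//; exact: measurable_tau_le.
have [n0 n0P] := block_geometric_decay q q001 (ltn0Sn (Num.truncn (T0 / delta))) (divr_gt0 e0 KR).
exists n0 => t n M tT n0n; have p0 : 0 <= pr P [set w | T 1 w <= t].
  by apply: pr_ge0; exact: measurable_arrived.
apply: (@le_trans _ _ (\sum_(n <= m < M) ((m.+1%:R ^+ q.+1 * q0 ^+ (m %/ K)) *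
    (K%:R * pr P [set w | T 1 w <= t])))).
  apply: ler_sum => m _; rewrite -mulrA ler_wpM2l ?exprn_ge0//.
  rewrite mulrCA mulrA; apply: pr_arrived_le; first exact: ltW.
  exact: le_lt_trans TK.
rewrite -mulr_suml mulrA ler_wpM2r//.
by rewrite -ler_pdivlMr//; exact: n0P.
Qed.

End renewal_theory.

Section renewal_measure.
Context {disp} {Omega : measurableType disp} {R : realType}.
Variable P : probability Omega R.
Variables (tau : nat -> {RV P >-> R}) (N : R -> {RV P >-> nat}).
Hypothesis N_renewal : renewal_process tau N.

Local Notation T n w := (arrival_time tau n w).
Local Open Scope ereal_scope.

Lemma measurable_arrival_timeR n :
  measurable_fun setT (fun w => T n w : measurableTypeR R).
Proof. exact: measurable_arrival_time. Qed.

(** Valued in the type on which Stieltjes measures are defined, so that its laws can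
be summed and compared with such a measure. *)
Definition arrival_rv n : {RV P >-> measurableTypeR R} :=
  HB.pack (fun w => T n w : measurableTypeR R)
    (isMeasurableFun.Build _ _ _ _ _ (measurable_arrival_timeR n)).

Lemma renewal_functionE t :
  renewal_function N t = \sum_(i <oo) P [set w | (T i.+1 w <= t)%R].
Proof.
rewrite /renewal_function; case: ifPn => [t0|]; last rewrite -leNgt => t0.
  by rewrite eseries0// => i _ _; rewrite (arrived_lt0 N_renewal)// measure0.
have NE w : ((N t w)%:R)%:E = \sum_(i <oo) (\1_[set w | (T i.+1 w <= t)%R] w)%:E :> \bar R.
  have E i : (\1_[set w | (T i.+1 w <= t)%R] w : R) = (i < N t w)%N%:R.
    by rewrite indicE mem_setE/= (count_geE N_renewal).
  rewrite (@nneseries_split _ _ 0 (N t w)) => [|k _]; last by rewrite lee_fin.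
  rewrite add0n [X in _ + X]eseries0 ?adde0 => [|i Ni _]; last first.
    by rewrite E ltnNge Ni.
  rewrite sumEFin; congr (_%:E).
  rewrite (eq_big_nat _ _ (F2 := fun=> 1%R)) => [|i /andP[_ iN]]; last by rewrite E iN.
  by rewrite sumr_const_nat subn0.
rewrite unlock (eq_integral (fun w => \sum_(i <oo)
   (\1_[set w | (T i.+1 w <= t)%R] w)%:E)) => [|w _]; last exact: NE.
have mT i : measurable [set w | (T i.+1 w <= t)%R] by exact: measurable_arrived.
rewrite integral_nneseries//.
  by apply: eq_eseriesr => i _; rewrite integral_indic// setIT.
- by move=> i; apply/measurable_EFinP; exact: measurable_indic.
Qed.

Variable lambda : cumulative R R.
Hypothesis lambdaE : forall t : R, (lambda t)%:E = renewal_function N t.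

(** Both measures give a left-open interval the expected number of arrivals in it. *)
Lemma lebesgue_stieltjes_renewal (B : set (measurableTypeR R)) : measurable B ->
  lebesgue_stieltjes_measure lambda B =
  mseries (fun i => distribution P (arrival_rv i.+1)) 0 B.
Proof.
apply: lebesgue_stieltjes_measure_unique => [I [[a b]]/= _ <-].
rewrite /lebesgue_stieltjes_measure /measure_extension/=.
rewrite measurable_mu_extE/=; last exact: is_ocitv.
have [ab | ba] := leP a b; last first.
  by rewrite set_itv_ge ?wlength0 ?measure0// bnd_simp -leNgt ltW.
rewrite wlength_itv_bnd// EFinB !lambdaE !renewal_functionE.
have mT i t : measurable [set w | (T i.+1 w <= t)%R] by exact: measurable_arrived.
have -> : \sum_(i <oo) P [set w | (T i.+1 w <= b)%R] =
    \sum_(i <oo) P [set w | (T i.+1 w <= a)%R] +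
    mseries (fun i => distribution P (arrival_rv i.+1)) 0 `]a, b]%classic.
  rewrite /mseries -nneseriesD//; apply: eq_eseriesr => i _.
  rewrite /distribution /pushforward /= -measureU//.
  - congr (P _); apply/seteqP; split => w /=; rewrite in_itv/=.
      by move=> ->; rewrite andbT; have [|] := leP (T i.+1 w) a; [left|right].
    by case=> [/le_trans ->//|/andP[]].
  - rewrite (_ : _ @^-1` _ = [set w | (a < T i.+1 w)%R] `&` [set w | (T i.+1 w <= b)%R]).
      apply: measurableI => //; apply: measurable_set_lt => //.
      exact: measurable_arrival_time.
    by apply/seteqP; split => w /=; rewrite in_itv/= => /andP.
  - apply/seteqP; split => w //= -[]; rewrite in_itv/= => Ta /andP[aT _].
    by move: Ta; rewrite leNgt aT.
by rewrite -renewal_functionE -lambdaE [X in X - _]addeC addeK.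
Qed.

Lemma integral_renewal (D : set (measurableTypeR R))
    (f : measurableTypeR R -> \bar R) : measurable D ->
  measurable_fun D f -> (forall s, D s -> 0 <= f s) ->
  \int[lebesgue_stieltjes_measure lambda]_(s in D) f s =
  \sum_(i <oo) \int[distribution P (arrival_rv i.+1)]_(s in D) f s.
Proof.
move=> mD mf f0.
rewrite (eq_measure_integral (mseries (fun i => distribution P (arrival_rv i.+1)) 0)).
  exact: ge0_integral_measure_series.
by move=> B mB _; exact: lebesgue_stieltjes_renewal.
Qed.

End renewal_measure.

(** * Dominated tails *)

Section dominated_tails.
Context {R : realType}.
Variable f : R -> R.
Hypotheses (f_gt0 : forall x, 0 < f x) (f_le1 : forall x, f x <= 1).
Hypothesis f_noninc : forall x y, x <= y -> f y <= f x.

(** Below the threshold [x0] the tail is at least [f x0], so a larger constant makes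
the doubling bound hold everywhere. *)
Lemma doubling_global : (exists c x0, forall x, x0 <= x -> f (x / 2) <= c * f x) ->
  exists q, forall x, f (x / 2) <= 2 ^+ q * f x.
Proof.
move=> [c [x0 cx0]].
pose c' := Num.max c (f x0)^-1.
exists (Num.truncn c').+1 => x.
have c'0 : 0 < c' by rewrite lt_max invr_gt0 f_gt0 orbT.
have c'2 : c' <= 2 ^+ (Num.truncn c').+1.
  rewrite (le_trans (ltW (truncnS_gt _)))// -natrX ler_nat.
  exact: ltnW (ltn_expl _ _).
apply: (@le_trans _ _ (c' * f x)); last by rewrite ler_wpM2r// ltW.
have [x0x|xx0] := leP x0 x.
  by rewrite (le_trans (cx0 _ x0x))// ler_wpM2r ?(ltW (f_gt0 _))// le_max lexx.
rewrite (le_trans (f_le1 _))// (@le_trans _ _ ((f x0)^-1 * f x))//.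
  by rewrite ler_pdivlMl// mulr1 f_noninc// ltW.
by rewrite ler_wpM2r ?(ltW (f_gt0 _))// le_max lexx orbT.
Qed.

(** The least power of two above [m] is at most [2 * m], so about [log_2 m] doublings
suffice and cost a power of [m]. *)
Lemma doubling_poly q : (forall x, f (x / 2) <= 2 ^+ q * f x) ->
  forall x (m : nat), 0 <= x -> (0 < m)%N -> f (x / m%:R) <= (2 * m%:R) ^+ q * f x.
Proof.
move=> dbl x m x0 m0.
have iter2 k : f (x / 2 ^+ k) <= (2 ^+ q) ^+ k * f x.
  elim: k => [|k IH]; first by rewrite !expr0 divr1 mul1r.
  rewrite exprSr invfM mulrA (le_trans (dbl _))// exprS -mulrA ler_wpM2l//.
pose k := (trunc_log 2 m).+1.
have mk : (m < 2 ^ k)%N by exact: trunc_log_ltn.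
have km : (2 ^ k <= 2 * m)%N by rewrite expnS leq_mul2l/= trunc_logP.
apply: (@le_trans _ _ (f (x / 2 ^+ k))).
  apply: f_noninc; rewrite ler_wpM2l// lef_pV2 ?posrE ?exprn_gt0 ?ltr0n//.
  by rewrite -natrX ler_nat ltnW.
apply: (le_trans (iter2 k)); rewrite ler_wpM2r//; first exact: ltW.
rewrite -exprM mulnC exprM; apply: lerXn2r; rewrite ?nnegrE ?exprn_ge0 ?mulr_ge0//.
by rewrite -natrX -natrM ler_nat.
Qed.

End dominated_tails.

(** * One-dimensional discounted sums *)

Section discounted_sums.
Context {disp} {Omega : measurableType disp} {R : realType}.
Variable P : probability Omega R.
Variables (tau : nat -> {RV P >-> R}) (N : R -> {RV P >-> nat}).
Hypothesis N_renewal : renewal_process tau N.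
Local Notation T n w := (arrival_time tau n w).

Variable Y : nat -> {RV P >-> R}.
Hypothesis Y_ge0 : forall i w, 0 <= Y i w.
Variable Fb : R -> R.
Hypothesis Y_law : forall i x, pr P [set w | x < Y i w] = Fb x.
Hypothesis Fb_gt0 : forall x, 0 < Fb x.
Variable q : nat.
Hypothesis Fb_poly : forall x (m : nat), 0 <= x -> (0 < m)%N ->
  Fb (x / m%:R) <= (2 * m%:R) ^+ q * Fb x.
Hypothesis Fb_long : forall L e : R, 0 < L -> 0 < e ->
  exists x0, forall x, x0 <= x -> Fb (x - L) <= (1 + e) * Fb x.
Hypothesis Y_tai : forall i j, i <> j -> forall e, 0 < e -> exists M, forall u v,
  M <= u -> M <= v -> pr P ([set w | u < Y i w] `&` [set w | v < Y j w]) <= e * Fb v.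

Variables (SY G : set_system Omega).
Hypotheses (mG : G `<=` measurable) (SY_closed : setI_closed SY).
Hypothesis SY_Y : forall i B, measurable B -> SY (Y i @^-1` B).
Hypothesis indepSYG : indep_classes P SY <<s G >>.
Hypothesis G_arrived : forall n t, <<s G >> [set w | T n w <= t].
Variables (W : nat -> Omega -> R) (C1 C2 : R).
Hypothesis C1_ge0 : 0 <= C1.
Hypothesis W_bounded : forall i w, - C1 <= W i w <= C2.
Hypothesis mW : forall i, measurable_fun setT (W i : g_sigma_algebraType G -> R).

(** The discount factor [expR (- W i w)] is moved to the level, so that given the
arrivals and the prices the claim is compared with a constant. *)
Definition exceeds (i : nat) (x t : R) : set Omega :=
  [set w | T i.+1 w <= t] `&` [set w | x * expR (W i w) < Y i w].

Lemma g_measurable_fun (f : Omega -> R) :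
  measurable_fun setT (f : g_sigma_algebraType G -> R) -> measurable_fun setT f.
Proof. by move=> mf _ B mB; apply: (g_sigma_sub mG); exact: mf. Qed.

Lemma measurable_Y_gt i x : measurable [set w | x < Y i w].
Proof. exact: measurable_set_lt. Qed.

Lemma measurable_exceeds i x t : measurable (exceeds i x t).
Proof.
apply: measurableI; first exact: measurable_arrived.
apply: measurable_set_lt => //; apply: measurable_funM => //.
by apply: measurableT_comp => //; exact: g_measurable_fun.
Qed.

Lemma SY_gt i x : SY [set w | x < Y i w].
Proof.
rewrite (_ : [set _ | _] = Y i @^-1` `]x, +oo[%classic); first exact: SY_Y.
by apply/seteqP; split => w /=; rewrite in_itv/= andbT.
Qed.

Lemma pr_indep E C : measurable E -> measurable C -> SY E -> <<s G >> C ->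
  pr P (C `&` E) = pr P C * pr P E.
Proof.
move=> mE mC SE GC; apply: EFin_inj; rewrite EFinM !prK//; last exact: measurableI.
by rewrite setIC muleC; exact: indepSYG.
Qed.

Lemma Fb_noninc x y : x <= y -> Fb y <= Fb x.
Proof.
move=> xy; rewrite -(Y_law 0 x) -(Y_law 0 y); apply: pr_le; try exact: measurable_Y_gt.
by move=> w /=; exact: le_lt_trans.
Qed.

Lemma expRW_le i w : expR (- C1) <= expR (W i w) <= expR C2.
Proof. by rewrite !ler_expR. Qed.

Lemma measurable_FbV i (a : R) :
  measurable_fun setT (fun w => Fb (a * expR (W i w))).
Proof.
apply: (measurableT_comp (f := Fb)).
  apply: nonincreasing_measurable => // x y xy; exact: Fb_noninc.
apply: measurable_funM => //; apply: measurableT_comp => //.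
exact: g_measurable_fun.
Qed.

(** Integrating the claim out, conditionally on the arrivals and the prices. *)
Lemma exceedsE i x t :
  P (exceeds i x t) = (\int[P]_w ((\1_[set w | T i.+1 w <= t] w) *
     Fb (x * expR (W i w)))%:E)%E.
Proof.
have mV : measurable_fun setT
    ((fun w => x * expR (W i w)) : g_sigma_algebraType G -> R).
  by apply: measurable_funM => //; apply: measurableT_comp => //; exact: mW.
have iY : indep_classes P (preimage_set_system setT (Y i) measurable) <<s G >>.
  move=> E C [B mB <-] GC; rewrite setTI; apply: indepSYG => //; exact: SY_Y.
rewrite /exceeds (freezing_tail mG iY mV (G_arrived i.+1 t)).
apply: eq_integral => w _; rewrite EFinM; congr (_ * _)%E.
by rewrite -(Y_law i) prK//; exact: measurable_Y_gt.
Qed.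

(** After integrating the claim out, the level [(x - L) e^W] differs from [x e^W] by at
most [L e^C2], a fixed shift, while [x e^W] is at least [x e^{- C1}] and hence large:
long-tailedness applies under the integral. *)
Lemma exceeds_shift (L e : R) : 0 < L -> 0 < e -> exists x0, forall x i t,
  x0 <= x -> pr P (exceeds i (x - L) t) <= (1 + e) * pr P (exceeds i x t).
Proof.
move=> L0 e0; have e1 : 0 <= 1 + e by rewrite addr_ge0// ltW.
have [x0 x0P] := Fb_long (mulr_gt0 L0 (expR_gt0 C2)) e0.
exists (Num.max 0 (x0 * expR C1)) => x i t; rewrite ge_max => /andP[x_ge0 x0x].
rewrite -lee_fin EFinM !prK; try exact: measurable_exceeds.
have mI a : measurable_fun setT
    (fun w => ((\1_[set w | T i.+1 w <= t] w) * Fb (a * expR (W i w)))%:E).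
  apply/measurable_EFinP; apply: measurable_funM; last exact: measurable_FbV.
  by apply: measurable_indic; exact: measurable_arrived.
have I0 a w : (0 <= ((\1_[set w | T i.+1 w <= t] w) * Fb (a * expR (W i w)))%:E)%E.
  by rewrite lee_fin mulr_ge0// ltW.
rewrite !exceedsE -ge0_integralZl//.
apply: ge0_le_integral => //; first by exact: measurable_funeM.
move=> w _; rewrite -EFinM lee_fin mulrCA ler_wpM2l//.
have /andP[h1 h2] := expRW_le i w.
apply: (le_trans _ (x0P _ _)).
  by apply: Fb_noninc; rewrite mulrBl lerB// ler_wpM2l// ltW.
by rewrite (le_trans _ (ler_wpM2l x_ge0 h1))// expRN ler_pdivlMr ?expR_gt0.
Qed.

Lemma arrived1 i t w : T i.+1 w <= t -> T 1 w <= t.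
Proof. by apply: le_trans; apply: (arrival_time_le N_renewal). Qed.

Lemma pr_exceeds0_ge x t : 0 <= x ->
  pr P [set w | T 1 w <= t] * Fb (x * expR C2) <= pr P (exceeds 0 x t).
Proof.
move=> x0; rewrite -(Y_law 0) -pr_indep//; try exact: measurable_arrived;
  try exact: measurable_Y_gt; last exact: SY_gt.
apply: pr_le; [|exact: measurable_exceeds|].
  by apply: measurableI; [exact: measurable_arrived|exact: measurable_Y_gt].
move=> w [/= Tw Yw]; split => //=; rewrite (le_lt_trans _ Yw)// ler_wpM2l//.
by have /andP[] := expRW_le 0 w.
Qed.

(** An integer bound for the discount factors, since the polynomial tail bound is
stated for integer scales. *)
Let B := (Num.truncn (expR C1)).+1.

Let expRN_le i w (x : R) : 0 <= x -> x / B%:R <= x * expR (W i w).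
Proof.
move=> x0; rewrite ler_wpM2l// (@le_trans _ _ (expR (- C1)))//; last first.
  by have /andP[] := expRW_le i w.
by rewrite expRN lef_pV2 ?posrE ?expR_gt0 ?ltr0n// ltW// truncnS_gt.
Qed.

Lemma pr_exceeds_le i x t : 0 <= x ->
  pr P (exceeds i x t) <= pr P [set w | T i.+1 w <= t] * Fb (x / B%:R).
Proof.
move=> x0; rewrite -(Y_law i) -pr_indep//; try exact: measurable_arrived;
  try exact: measurable_Y_gt; last exact: SY_gt.
apply: pr_le; [exact: measurable_exceeds| |].
  by apply: measurableI; [exact: measurable_arrived|exact: measurable_Y_gt].
by move=> w [/= Tw Yw]; split => //=; rewrite (le_lt_trans _ Yw)//; exact: expRN_le.
Qed.

Lemma pr_joint_le i j u v t e : 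
  pr P ([set w | u < Y i w] `&` [set w | v < Y j w]) <= e ->
  pr P ([set w | T 1 w <= t] `&` ([set w | u < Y i w] `&` [set w | v < Y j w]))
    <= pr P [set w | T 1 w <= t] * e.
Proof.
move=> h; rewrite pr_indep//.
- by rewrite ler_wpM2l// pr_ge0//; exact: measurable_arrived.
- by apply: measurableI; exact: measurable_Y_gt.
- exact: measurable_arrived.
- by apply: SY_closed; exact: SY_gt.
Qed.

(** Finitely many pairs share a threshold. *)
Lemma tai_unif (n : nat) (e : R) : 0 < e -> exists M, forall i j,
  (i < n)%N -> (j < n)%N -> i <> j -> forall u v, M <= u -> M <= v ->
  pr P ([set w | u < Y i w] `&` [set w | v < Y j w]) <= e * Fb v.
Proof.
move=> e0.
have h (k : nat * nat) : exists M, k.1 <> k.2 -> forall u v, M <= u -> M <= v ->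
    pr P ([set w | u < Y k.1 w] `&` [set w | v < Y k.2 w]) <= e * Fb v.
  have [E|/eqP ne] := eqVneq k.1 k.2; first by exists 0.
  by have [M h] := Y_tai ne e0; exists M => _.
have [M hM] := choice h.
exists (\sum_(i < n) \sum_(j < n) `|M (i : nat, j : nat)|) => i j ni nj ij u v.
have le : M (i, j) <= \sum_(i < n) \sum_(j < n) `|M (i : nat, j : nat)|.
  rewrite (bigD1 (Ordinal ni))//= (bigD1 (Ordinal nj))//=.
  rewrite -addrA (le_trans (ler_norm _))// lerDl addr_ge0 ?sumr_ge0// => k _.
  by rewrite sumr_ge0.
by move=> Mu Mv; apply: (hM (i, j)) => //=; exact: le_trans le _.
Qed.

Lemma total_ge (g x t : R) n :
  g%:E = (\sum_(i <oo) P (exceeds i x t))%E -> \sum_(i < n) pr P (exceeds i x t) <= g.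
Proof.
move=> gE; rewrite -lee_fin gE -sumEFin.
rewrite (eq_bigr (fun i : 'I_n => P (exceeds i x t))) => [|i _]; last first.
  by rewrite prK//; exact: measurable_exceeds.
rewrite -(big_mkord xpredT (fun i => P (exceeds i x t))).
by apply: nneseries_lim_ge => i _ _; exact: measure_ge0.
Qed.

Lemma total_le (g x t d : R) n :
  g%:E = (\sum_(i <oo) P (exceeds i x t))%E ->
  (forall M, \sum_(n <= i < M) pr P (exceeds i x t) <= d) ->
  g <= \sum_(i < n) pr P (exceeds i x t) + d.
Proof.
move=> gE h; rewrite -lee_fin gE EFinD -sumEFin.
rewrite (@nneseries_split _ _ 0 n) => [|k _]; last exact: measure_ge0.
rewrite add0n big_mkord leeD//.
  by apply: lee_sum => i _; rewrite prK//; exact: measurable_exceeds.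
apply: lime_le; first by apply: is_cvg_nneseries => *; exact: measure_ge0.
apply: nearW => M; have := h M; rewrite -lee_fin => /(le_trans _); apply.
rewrite -sumEFin; apply: lee_sum => i _.
by rewrite prK//; exact: measurable_exceeds.
Qed.

Let KB : R := (2 * B%:R) ^+ q.

Let KB_gt0 : 0 < KB. Proof. by rewrite exprn_gt0// mulr_gt0// ltr0n. Qed.

Local Notation p t := (pr P [set w | T 1 w <= t]).

Let p_ge0 t : 0 <= p t. Proof. by apply: pr_ge0; exact: measurable_arrived. Qed.

Lemma exceeds_tail (T0 e : R) : 0 < e -> exists n, forall x t M, 0 <= x -> t <= T0 ->
  \sum_(n <= i < M) pr P (exceeds i x t) <= e * (p t * Fb x).
Proof.
move=> e0; have [n h] := arrived_moment_tail N_renewal T0 0 (divr_gt0 e0 KB_gt0).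
exists n => x t M x0 tT.
apply: (@le_trans _ _ (\sum_(n <= i < M)
    ((i.+1%:R ^+ 1 * pr P [set w | T i.+1 w <= t]) * (KB * Fb x)))).
  apply: ler_sum => i _; apply: (le_trans (pr_exceeds_le _ _ x0)).
  have pi0 : 0 <= pr P [set w | T i.+1 w <= t].
    by apply: pr_ge0; exact: measurable_arrived.
  apply: ler_pM => //; first exact: ltW.
    by rewrite expr1 ler_peMl// ler1n.
  exact: Fb_poly.
rewrite -mulr_suml !mulrA ler_wpM2r ?(ltW (Fb_gt0 _))//.
rewrite -ler_pdivlMr// mulrAC; exact: h.
Qed.

(** [S] contains all the single events, and the first [n] of them are almost disjoint
by tail asymptotic independence; the remaining ones add a negligible amount to the
total [g]. *)
Lemma pr_ge_total (T0 e : R) : 0 < e -> exists x0, forall x t g (S : set Omega),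
  x0 <= x -> t <= T0 -> measurable S -> (forall i, exceeds i x t `<=` S) ->
  g%:E = (\sum_(i <oo) P (exceeds i x t))%E -> g <= pr P S + e * (p t * Fb x).
Proof.
move=> e0; have e20 : 0 < e / 2 by exact: divr_gt0.
have [n hn] := exceeds_tail T0 e20.
have n20 : 0 < (n ^ 2)%:R + 1 :> R by rewrite ltr_wpDl.
(* At most [n ^ 2] pairs, each with a factor [KB] to come back from the level
[x / B] to [x]; the [+ 1] allows [n = 0]. *)
have d0 : 0 < e / 2 / ((n ^ 2)%:R + 1) / KB by rewrite !divr_gt0.
have [M hM] := tai_unif n d0.
exists (Num.max 0 (M * B%:R)) => x t g S; rewrite ge_max => /andP[x0 Mx] tT mS ES gE.
have BM : M <= x / B%:R by rewrite ler_pdivlMr ?ltr0n.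
set c := p t * Fb x; have c0 : 0 <= c by rewrite mulr_ge0 ?(ltW (Fb_gt0 _)).
have pairs i j : (i < j < n)%N -> pr P (exceeds i x t `&` exceeds j x t) <=
    e / 2 / ((n ^ 2)%:R + 1) * c.
  move=> /andP[ij jn]; have ne : i <> j by lia.
  have := hM i j (ltn_trans ij jn) jn ne _ _ BM BM => h.
  apply: (@le_trans _ _ (p t * (e / 2 / ((n ^ 2)%:R + 1) / KB * Fb (x / B%:R)))).
    apply: le_trans (pr_joint_le t h); apply: pr_le.
    - by apply: measurableI; exact: measurable_exceeds.
    - apply: measurableI; first exact: measurable_arrived.
      by apply: measurableI; exact: measurable_Y_gt.
    - move=> w [[/= Tw Yi] [_ /= Yj]]; split => /=; first exact: arrived1 Tw.
      by split; [apply: (le_lt_trans _ Yi)|apply: (le_lt_trans _ Yj)]; exact: expRN_le.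
  rewrite /c [leRHS]mulrCA ler_wpM2l// -[leLHS]mulrA ler_wpM2l//.
    by rewrite ltW// !divr_gt0.
  by rewrite ler_pdivrMl// Fb_poly.
have e'0 : 0 <= e / 2 / ((n ^ 2)%:R + 1) * c by rewrite mulr_ge0// ltW// !divr_gt0.
have mE i := measurable_exceeds i x t.
have h1 := pr_bigsetU_ge mE e'0 pairs.
have h2 : pr P (\big[setU/set0]_(i < n) exceeds i x t) <= pr P S.
  apply: pr_le => //; first exact: bigsetU_measurable.
  by rewrite -(bigcup_mkord n (fun i => exceeds i x t)) => w [i _]; exact: ES.
have h3 := total_le gE (fun M => hn x t M x0 tT); rewrite -/c in h3.
have h4 : (n ^ 2)%:R * (e / 2 / ((n ^ 2)%:R + 1) * c) <= e / 2 * c.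
  rewrite mulrA ler_wpM2r// mulrCA ger_pMr// ler_pdivrMr// mul1r lerDl//.
rewrite (splitr e) mulrDl; lra.
Qed.

Definition discounted_total t w : R := \sum_(i < N t w) expR (- W i w) * Y i w.

Lemma sum_gt_ex n (f : nat -> R) y : 0 <= y -> y < \sum_(i < n) f i ->
  exists2 i, (i < n)%N & y / n%:R < f i.
Proof.
move=> y0; apply: contraPP => h; apply/negP; rewrite -leNgt.
have [->|n0] := posnP n; first by rewrite big_ord0.
apply: (@le_trans _ _ (\sum_(i < n) y / n%:R)).
  apply: ler_sum => i _; rewrite leNgt; apply/negP => lt; apply: h.
  by exists i.
by rewrite sumr_const card_ord -[leLHS]mulr_natr divfK// pnatr_eq0 -lt0n.
Qed.

Let expRNY_le i w : expR (- W i w) * Y i w <= B%:R * Y i w.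
Proof.
rewrite ler_wpM2r// (@le_trans _ _ (expR C1))//; last by rewrite ltW// truncnS_gt.
by rewrite ler_expR lerNl; have /andP[] := W_bounded i w.
Qed.

Let Y_gt_of i w (z : R) : z < expR (- W i w) * Y i w -> z / B%:R < Y i w.
Proof.
by move=> h; rewrite ltr_pdivrMr ?ltr0n// mulrC (lt_le_trans h).
Qed.

Lemma exceedsP i t w z : 0 <= t -> (i < N t w)%N ->
  z < expR (- W i w) * Y i w -> exceeds i z t w.
Proof.
move=> t0 iN h; split => /=; first by rewrite -(count_geE N_renewal).
by rewrite -ltr_pdivlMr ?expR_gt0// -expRN mulrC.
Qed.

(** If [m] claims sum to more than [x], one of them is more than an [m]-th of it: this
costs a power of [m] in the tail bound and a factor [m] in the union bound, both
absorbed by the decay of the arrival probabilities. *)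
Lemma many_claims (T0 e : R) : 0 < e -> exists n, forall x t, 0 <= x -> 0 <= t <= T0 ->
  forall S, measurable S ->
  S `<=` [set w | (n < N t w)%N /\ x < discounted_total t w] ->
  pr P S <= e * (p t * Fb x).
Proof.
move=> e0; have [n h] := arrived_moment_tail N_renewal T0 q (divr_gt0 e0 KB_gt0).
exists n => x t x0 /andP[t0 tT] S mS Ssub.
pose E m := \big[setU/set0]_(i < m.+1)
  ([set w | T m.+1 w <= t] `&` [set w | x / (B * m.+1)%:R < Y i w]).
have mEi m i : measurable
    ([set w | T m.+1 w <= t] `&` [set w | x / (B * m.+1)%:R < Y i w]).
  by apply: measurableI; [exact: measurable_arrived|exact: measurable_Y_gt].
have mE m : measurable (E m) by exact: bigsetU_measurable.
apply: (pr_bigcup_le (n0 := n) mE) => //.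
  move=> w /Ssub[nN xD]; have [i iN xi] :=
    @sum_gt_ex (N t w) (fun i => expR (- W i w) * Y i w) x x0 xD.
  case NE : (N t w) => [|m]; first by rewrite NE in nN.
  exists m => /=; first by rewrite -ltnS -NE.
  rewrite /E -(bigcup_mkord m.+1 (fun i => _ `&` [set w | x / (B * m.+1)%:R < Y i w])).
  exists i => /=; first by rewrite -NE.
  split => /=; first by rewrite -(count_geE N_renewal)// NE.
  by rewrite natrM invfM mulrCA mulrC -NE Y_gt_of.
move=> M; apply: (@le_trans _ _ (\sum_(n <= m < M)
    ((m.+1%:R ^+ q.+1 * pr P [set w | T m.+1 w <= t]) * (KB * Fb x)))).
  apply: ler_sum => m _; apply: (le_trans (pr_bigsetU P m.+1 (mEi m))).
  have pm0 : 0 <= pr P [set w | T m.+1 w <= t].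
    by apply: pr_ge0; exact: measurable_arrived.
  have le1 : Fb (x / (B * m.+1)%:R) <= KB * m.+1%:R ^+ q * Fb x.
    by rewrite (le_trans (Fb_poly _ _))// natrM mulrA exprMn.
  apply: (@le_trans _ _ (\sum_(i < m.+1)
     pr P [set w | T m.+1 w <= t] * (KB * m.+1%:R ^+ q * Fb x))).
    apply: ler_sum => i _; rewrite pr_indep ?Y_law ?ler_wpM2l//.
    - exact: measurable_Y_gt.
    - exact: measurable_arrived.
    - exact: SY_gt.
  rewrite sumr_const card_ord -[leLHS]mulr_natl exprS.
  by rewrite le_eqVlt; apply/orP; left; apply/eqP; ring.
rewrite -mulr_suml !mulrA ler_wpM2r ?(ltW (Fb_gt0 _))//.
rewrite -ler_pdivlMr// mulrAC; exact: h.
Qed.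

(** Some discounted claim is at least an [n]-th of the total [x]. If it does not exceed
[x - L], the others sum to more than [L], and a second claim is more than an [n]-th
of [L]. *)
Lemma few_claims n (x L t : R) w : 0 <= L -> L < x -> 0 <= t -> (N t w <= n)%N ->
  x < discounted_total t w ->
  (exists2 i, (i < n)%N & exceeds i (x - L) t w) \/
  exists i j, [/\ (i < n)%N && (j < n)%N, i <> j, T 1 w <= t,
    L / (B * n)%:R < Y i w & x / (B * n)%:R < Y j w].
Proof.
move=> L0 Lx t0 Nn xD; have x0 : 0 <= x by rewrite (le_trans L0)// ltW.
pose a i := expR (- W i w) * Y i w.
have a0 i : 0 <= a i by rewrite mulr_ge0// expR_ge0.
have N0 : (0 < N t w)%N.
  rewrite lt0n; apply/negP => /eqP N0; move: xD.
  by rewrite /discounted_total N0 big_ord0 ltNge x0.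
have scale z i : 0 <= z -> z / (N t w)%:R < a i -> z / (B * n)%:R < Y i w.
  move=> z0 /Y_gt_of; apply: le_lt_trans.
  rewrite natrM invfM mulrA mulrAC ler_wpM2r// ler_wpM2l// lef_pV2 ?posrE ?ltr0n//.
    by rewrite ler_nat.
  exact: leq_trans N0 Nn.
have [[i iN xi]|small] := pselect (exists2 i, (i < N t w)%N & x - L < a i).
  by left; exists i; [exact: leq_trans iN Nn|exact: exceedsP].
right; have [j jN xj] := sum_gt_ex (f := a) x0 xD.
have aj : a j <= x - L by rewrite leNgt; apply/negP => ?; apply: small; exists j.
have : L < \sum_(k < N t w) (if k == j :> nat then 0 else a k).
  move: xD; rewrite /discounted_total (bigD1 (Ordinal jN))//= [X in _ -> L < X](bigD1 (Ordinal jN))//=.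
  rewrite eqxx add0r (eq_bigr (fun k : 'I_(N t w) => if k == j :> nat then 0 else a k)).
    by rewrite -/(a j); lra.
  by move=> k; rewrite -val_eqE/= => /negbTE ->.
move=> /(sum_gt_ex (f := fun k => if k == j then 0 else a k) L0)[i iN].
rewrite /=; case: (eqVneq i j) => [_|ij]; first by rewrite ltNge divr_ge0.
move=> Li; exists i, j; split => //.
- by rewrite (leq_trans iN Nn) (leq_trans jN Nn).
- exact/eqP.
- by rewrite -(count_geE N_renewal).
- exact: scale Li.
- exact: scale xj.
Qed.

(** [L] is chosen after [n] to make pairs of large claims unlikely, and [x] after [L] to
make the shift of the level by [L] negligible. *)
Lemma pr_le_total (T0 e : R) : 0 < e -> exists x0, forall x t g (S : set Omega),
  x0 <= x -> 0 <= t <= T0 -> measurable S ->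
  S `<=` [set w | x < discounted_total t w] ->
  g%:E = (\sum_(i <oo) P (exceeds i x t))%E ->
  pr P S <= (1 + e) * g + e * (p t * Fb x).
Proof.
move=> e0; have e20 : 0 < e / 2 by exact: divr_gt0.
have [n' hn'] := many_claims T0 e20; pose n := n'.+1.
have n20 : 0 < (n ^ 2)%:R :> R by rewrite ltr0n.
pose Bn := (B * n)%N; have Bn0 : (0 < Bn)%N by [].
have BnR : 0 < Bn%:R :> R by rewrite ltr0n.
pose Kn : R := (2 * Bn%:R) ^+ q.
have Kn0 : 0 < Kn by rewrite exprn_gt0// mulr_gt0.
(* At most [n ^ 2] pairs, each with a factor [Kn] to come back from the level
[x / (B * n)] to [x]. *)
have d0 : 0 < e / 2 / (n ^ 2)%:R / Kn by rewrite !divr_gt0.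
have [M hM] := tai_unif n d0.
pose L := Num.max 1 (M * Bn%:R).
have L0 : 0 < L by rewrite lt_max ltr01.
have ML : M <= L / Bn%:R by rewrite ler_pdivlMr// le_max lexx orbT.
have [x1 hx1] := exceeds_shift L0 e0.
exists (Num.max x1 (L + 1)) => x t g S; rewrite ge_max => /andP[x1x Lx].
move=> /andP[t0 tT] mS Ssub gE.
have {}Lx : L < x by rewrite (lt_le_trans _ Lx)// ltrDl.
have x0 : 0 <= x by rewrite ltW// (lt_trans L0).
set c := p t * Fb x; have c0 : 0 <= c by rewrite mulr_ge0 ?(ltW (Fb_gt0 _)).
have Mx : M <= x / Bn%:R by rewrite (le_trans ML)// ler_wpM2r// ltW.
have mN : measurable [set w | (n' < N t w)%N].
  rewrite (_ : [set _ | _] = [set w | T n'.+1 w <= t]).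
    exact: measurable_arrived.
  by apply/seteqP; split => w /=; rewrite (count_geE N_renewal).
pose U := \big[setU/set0]_(i < n) exceeds i (x - L) t.
pose Vij i j := if i == j then set0 else [set w | T 1 w <= t] `&`
  ([set w | L / Bn%:R < Y i w] `&` [set w | x / Bn%:R < Y j w]).
pose V := \big[setU/set0]_(i < n) \big[setU/set0]_(j < n) Vij i j.
have mVij i j : measurable (Vij i j).
  rewrite /Vij; case: ifP => // _; apply: measurableI; first exact: measurable_arrived.
  by apply: measurableI; exact: measurable_Y_gt.
have mV' i : measurable (\big[setU/set0]_(j < n) Vij i j) by exact: bigsetU_measurable.
have mU : measurable U by apply: bigsetU_measurable => i _; exact: measurable_exceeds.
have mV : measurable V by exact: bigsetU_measurable.
have h1 : pr P (S `&` [set w | (n' < N t w)%N]) <= e / 2 * c.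
  apply: (hn' x t x0); first by rewrite t0.
    exact: measurableI.
  by move=> w [/Ssub xD nN].
have h2 : pr P U <= (1 + e) * g.
  apply: (le_trans (pr_bigsetU P n (fun i => measurable_exceeds i (x - L) t))).
  apply: (@le_trans _ _ (\sum_(i < n) (1 + e) * pr P (exceeds i x t))).
    by apply: ler_sum => i _; exact: hx1.
  by rewrite -mulr_sumr ler_wpM2l ?total_ge// addr_ge0// ltW.
have h3ij i j : (i < n)%N -> (j < n)%N -> pr P (Vij i j) <= e / 2 / (n ^ 2)%:R * c.
  move=> ni nj; rewrite /Vij; case: ifPn => [_|/eqP ij].
    by rewrite /pr measure0 mulr_ge0// ltW// divr_gt0.
  apply: (le_trans (pr_joint_le t (hM i j ni nj ij _ _ ML Mx))).
  rewrite /c [leRHS]mulrCA ler_wpM2l// -[leLHS]mulrA ler_wpM2l//.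
    by rewrite ltW// divr_gt0.
  by rewrite ler_pdivrMl// Fb_poly.
have h3 : pr P V <= e / 2 * c.
  apply: (le_trans (pr_bigsetU P n mV')).
  apply: (@le_trans _ _ (\sum_(i < n) \sum_(j < n) e / 2 / (n ^ 2)%:R * c)).
    apply: ler_sum => i _; apply: (le_trans (pr_bigsetU P n (mVij i))).
    by apply: ler_sum => j _; exact: h3ij.
  rewrite !sumr_const !card_ord -mulrnA mulnn -[leLHS]mulr_natl.
  by rewrite mulrA [X in X * c <= _]mulrC divfK// gt_eqF.
have Scov : S `<=` (S `&` [set w | (n' < N t w)%N]) `|` (U `|` V).
  move=> w Sw; have [nN|Nn] := ltnP n' (N t w); first by left.
  have Nn1 : (N t w <= n)%N by rewrite (leq_trans Nn).
  right; case: (few_claims (ltW L0) Lx t0 Nn1 (Ssub w Sw)).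
    move=> [i ni Ei]; left; rewrite /U -(bigcup_mkord n (fun i => exceeds i (x - L) t)).
    by exists i.
  move=> [i [j [/andP[ni nj] ij Tw Li xj]]]; right.
  rewrite /V -(bigcup_mkord n (fun i => \big[setU/set0]_(j < n) Vij i j)).
  exists i => //; rewrite -(bigcup_mkord n (Vij i)); exists j => //.
  by rewrite /Vij; case: ifPn => [/eqP //|_].
have mSN : measurable (S `&` [set w | (n' < N t w)%N]) by exact: measurableI.
have mUV : measurable (U `|` V) by exact: measurableU.
have h4 := pr_le P mS (measurableU _ _ mSN mUV) Scov.
have h5 := pr_setU P mSN mUV; have h6 := pr_setU P mU mV.
rewrite [X in _ + X * c](splitr e) mulrDl; lra.
Qed.

(** The first term alone bounds the total [g] below by a multiple of [p t * Fb x], which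
turns the additive errors of [pr_ge_total] and [pr_le_total] into relative ones. *)
Lemma single_big_claim (T0 e : R) : 0 < e -> exists x0, forall x t g (S : set Omega),
  x0 <= x -> 0 <= t <= T0 -> 0 < p t -> measurable S ->
  (forall i, exceeds i x t `<=` S) ->
  S `<=` [set w | x < discounted_total t w] ->
  g%:E = (\sum_(i <oo) P (exceeds i x t))%E ->
  0 < g /\ `|pr P S / g - 1| <= e.
Proof.
move=> e0.
pose m := (Num.truncn (expR C2)).+1.
pose K : R := (2 * m%:R) ^+ q.
have K0 : 0 < K by rewrite exprn_gt0// mulr_gt0// ltr0n.
pose d := e / (1 + K).
have K1 : 0 < 1 + K by rewrite addr_gt0.
have d0 : 0 < d by rewrite divr_gt0.
have [x1 h1] := pr_ge_total T0 d0; have [x2 h2] := pr_le_total T0 d0.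
exists (Num.max 0 (Num.max x1 x2)) => x t g S.
rewrite !ge_max => /and3P[x0 x1x x2x] tT pt mS ES Ssub gE.
have Kg : p t * Fb x <= K * g.
  apply: (@le_trans _ _ (K * (p t * Fb (x * expR C2)))).
    rewrite mulrCA ler_wpM2l//.
    have := @Fb_poly (x * m%:R) m (mulr_ge0 x0 (ler0n _ m)) isT.
    rewrite mulfK ?pnatr_eq0// => /le_trans; apply.
    rewrite ler_wpM2l ?(ltW K0)//.
    by apply: Fb_noninc; rewrite ler_wpM2l// ltW// truncnS_gt.
  rewrite ler_wpM2l ?(ltW K0)// (le_trans (pr_exceeds0_ge t x0))//.
  by have := total_ge 1 gE; rewrite big_ord1.
have g0 : 0 < g.
  by rewrite -(pmulr_rgt0 _ K0) (lt_le_trans _ Kg)// mulr_gt0.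
split => //.
have t0T := tT; move: tT => /andP[t0 tT].
have l1 := h1 x t g S x1x tT mS ES gE; have l2 := h2 x t g S x2x t0T mS Ssub gE.
have dK : d * (p t * Fb x) <= d * (K * g) by rewrite ler_wpM2l// ltW.
have eE : e = d + d * K by rewrite /d; field; rewrite gt_eqF.
have -> : pr P S / g - 1 = (pr P S - g) / g by field; rewrite gt_eqF.
rewrite normrM (gtr0_norm (x := g^-1)) ?invr_gt0// ler_pdivrMr// ler_norml eE.
have dg : 0 <= d * g by rewrite mulr_ge0// ltW.
apply/andP; split; nra.
Qed.

End discounted_sums.

(** * The multivariate model *)

Section clamp.
Context {R : realType}.

Definition clamp (a b y : R) := Num.max a (Num.min b y).

Lemma clamp_id a b y : a <= y <= b -> clamp a b y = y.
Proof. by move=> /andP[ay yb]; rewrite /clamp (min_idPr yb) (max_idPr ay). Qed.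

Lemma clamp_bounds a b y : a <= b -> a <= clamp a b y <= b.
Proof. by move=> ab; rewrite /clamp le_max lexx/= ge_max ab ge_min lexx. Qed.

Lemma measurable_clamp disp (T : measurableType disp) a b (f : T -> R) :
  measurable_fun setT f -> measurable_fun setT (fun w => clamp a b (f w)).
Proof. by move=> mf; apply: measurable_maxr => //; exact: measurable_minr. Qed.

End clamp.

Lemma cvg_ereal0 {R : realType} (h : R -> \bar R) : (forall x, (0 <= h x)%E) ->
  (forall e : R, 0 < e -> exists x0, forall x, x0 <= x -> (h x <= e%:E)%E) ->
  h x @[x --> +oo] --> 0%E.
Proof.
move=> h0 hs.
have fin x (e : R) : (h x <= e%:E)%E -> h x \is a fin_num.
  by move=> he; rewrite ge0_fin_numE// (le_lt_trans he)// ltry.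
apply/fine_cvgP; split.
  have [x0 h1] := hs 1 ltr01; exists x0; split => [|x x0x]; first exact: num_real.
  by apply: fin (h1 x (ltW x0x)).
apply/cvgrPdist_le => e e0; have [x0 he] := hs e e0.
exists x0; split => [|x /ltW/he hxe]; first exact: num_real.
rewrite sub0r normrN ger0_norm ?fine_ge0//.
by rewrite -lee_fin fineK//; exact: fin hxe.
Qed.

Section model.
Context (R : realType) (d : nat) (disp : measure_display)
  (Omega : measurableType disp) (P : probability Omega R).
Variables (A : set 'rV[R]_d) (F : probability (borel_rV R d) R).
Hypotheses (A_ruin : ruin_family A) (F_class : in_class_DL_along F A).
Variable X : nat -> {RV P >-> borel_rV R d}.
Hypothesis X_ge0 : forall i w, nonneg_vec (X i w : 'rV[R]_d).
Hypothesis X_law : forall i, has_law (X i) F.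
Hypothesis X_tai : forall i j, i <> j ->
    tail_asymp_indep P (fun w => radial_sup A (X i w))
                       (fun w => radial_sup A (X j w)).

Lemma measurable_gauge i : measurable_fun setT (fun w => radial_sup A (X i w)).
Proof. exact: measurable_radial_sup. Qed.

Definition gauge i : {RV P >-> R} :=
  HB.pack (fun w => radial_sup A (X i w))
    (isMeasurableFun.Build _ _ _ _ _ (measurable_gauge i)).

Definition gauge_tail (x : R) : R := pr P [set w | x < gauge 0 w].

Lemma gauge_ge0 i w : 0 <= gauge i w. Proof. exact: radial_sup_ge0. Qed.

Lemma law_radial_sup i x : 0 <= x ->
  P [set w | x < gauge i w] = F [set v | x < radial_sup A v].
Proof.
move=> x0; rewrite -(X_law i); first by [].
by apply: measurable_open_rV; exact: open_radial_sup_gt.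
Qed.

Lemma gauge_law i x : pr P [set w | x < gauge i w] = gauge_tail x.
Proof.
rewrite /gauge_tail /pr; have [x0|x0] := leP 0 x; first by rewrite !law_radial_sup.
have E k : [set w | x < gauge k w] = setT.
  by apply/seteqP; split => // w _ /=; rewrite (lt_le_trans x0)// gauge_ge0.
by rewrite !E.
Qed.

Lemma tail_law_along x : 0 <= x -> tail (law_along F A) x = gauge_tail x.
Proof.
move=> x0; rewrite /tail /law_along /pushforward /gauge_tail /pr law_radial_sup//.
by congr (fine (F _)); apply/seteqP; split => v /=; rewrite in_itv/= andbT.
Qed.

Lemma gauge_tail_gt0 x : 0 < gauge_tail x.
Proof.
have [x0|x0] := leP 0 x.
  by rewrite -tail_law_along//; case: F_class => h _ _; exact: h.
rewrite /gauge_tail /pr (_ : [set _ | _] = setT) ?probability_setT ?ltr01//.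
by apply/seteqP; split => // w _ /=; rewrite (lt_le_trans x0)// gauge_ge0.
Qed.

Lemma gauge_tail_noninc x y : x <= y -> gauge_tail y <= gauge_tail x.
Proof.
by move=> xy; apply: pr_le; try exact: measurable_set_lt; move=> w /=; exact: le_lt_trans.
Qed.

Lemma gauge_tail_poly : exists q, forall x (m : nat), 0 <= x -> (0 < m)%N ->
  gauge_tail (x / m%:R) <= (2 * m%:R) ^+ q * gauge_tail x.
Proof.
have le1 x : gauge_tail x <= 1 by apply: pr_le1; exact: measurable_set_lt.
suff /(doubling_global gauge_tail_gt0 le1 gauge_tail_noninc)[q dbl] :
    exists c x0, forall x, x0 <= x -> gauge_tail (x / 2) <= c * gauge_tail x.
  by exists q; exact: (doubling_poly gauge_tail_gt0 gauge_tail_noninc dbl).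
case: F_class => _ /(_ (1 / 2)) + _.
have half : 0 < (1 / 2 : R) < 1 by apply/andP; split; lra.
move=> /(_ half); rewrite /limf_esup => /ereal_inf_lt[_ [V [x0 [_ x0V]] <-]] Vy.
have [c cV] : exists c : R, forall x, V x ->
    tail (law_along F A) (1 / 2 * x) / tail (law_along F A) x <= c.
  have Vs x : V x -> ((tail (law_along F A) (1 / 2 * x) / tail (law_along F A) x)%:E
      <= ereal_sup [set (tail (law_along F A) (1 / 2 * x) / tail (law_along F A) x)%:E
        | x in V])%E by move=> Vx; apply: ereal_sup_ubound; exists x.
  move: Vs Vy; case: ereal_sup => [r| |] // Vs _; first by exists r => x /Vs; rewrite lee_fin.
  by exists 0 => x /Vs; rewrite leeNy_eq.
exists c, (Num.max 1 (x0 + 1)) => x; rewrite ge_max => /andP[x1 x0x].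
have x_ge0 : 0 <= x by rewrite (le_trans _ x1).
have Vx : V x by apply: x0V; rewrite (lt_le_trans _ x0x)// ltrDl.
have := cV x Vx; rewrite !tail_law_along ?mulr_ge0//.
by rewrite ler_pdivrMr ?gauge_tail_gt0// mul1r [_^-1 * _]mulrC.
Qed.

Lemma gauge_tail_long (L e : R) : 0 < L -> 0 < e ->
  exists x0, forall x, x0 <= x -> gauge_tail (x - L) <= (1 + e) * gauge_tail x.
Proof.
move=> L0 e0; case: F_class => _ _ /(_ L L0) /cvgrPdist_le /(_ e e0)[x0 [_ h]].
exists (Num.max L (x0 + 1)) => x; rewrite ge_max => /andP[Lx x0x].
have := h x (lt_le_trans (ltr_pwDr ltr01 (lexx _)) x0x).
rewrite !tail_law_along ?subr_ge0// ?(le_trans (ltW L0))//.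
rewrite distrC => /(le_trans (ler_norm _)); rewrite lerBlDr [e + 1]addrC.
by rewrite ler_pdivrMr ?gauge_tail_gt0.
Qed.

Lemma gauge_tai i j : i <> j -> forall e, 0 < e -> exists M, forall u v,
  M <= u -> M <= v ->
  pr P ([set w | u < gauge i w] `&` [set w | v < gauge j w]) <= e * gauge_tail v.
Proof.
move=> ij e e0; have /cvgrPdist_le /(_ e e0) := X_tai ij.
move=> [[U V] /= [[u0 [_ hu]] [v0 [_ hv]]] h].
exists (Num.max u0 v0 + 1) => u v uM vM.
have u0u : u0 < u by rewrite (lt_le_trans _ uM)// ltr_pwDr// le_max lexx.
have v0v : v0 < v by rewrite (lt_le_trans _ vM)// ltr_pwDr// le_max lexx orbT.
have /= := h (u, v) (conj (hu u u0u) (hv v v0v)).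
rewrite sub0r normrN /cond_prob => /(le_trans (ler_norm _)).
have := gauge_law j v; rewrite /pr /= => ->.
by rewrite ler_pdivrMr ?gauge_tail_gt0.
Qed.

Variables (tau : nat -> {RV P >-> R}) (N : R -> {RV P >-> nat}).
Hypothesis N_renewal : renewal_process tau N.
Variable xi : R -> {RV P >-> R}.
Hypothesis xi_cadlag : forall w, cadlag (fun t => xi t w).
Local Notation T n w := (arrival_time tau n w).

Definition sigmaNxi : set_system Omega :=
  setI_class (sigma_gen `[0, +oo[ N) (sigma_gen `[0, +oo[ xi).

Lemma sigma_genX_measurable : sigma_gen setT X `<=` measurable.
Proof. by apply: sigma_gen_measurable => i _. Qed.

Lemma sigma_genN_measurable : sigma_gen `[0, +oo[ N `<=` measurable.
Proof. by apply: sigma_gen_measurable => i _. Qed.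

Lemma sigma_genxi_measurable : sigma_gen `[0, +oo[ xi `<=` measurable.
Proof. by apply: sigma_gen_measurable => i _. Qed.

Lemma sigmaNxi_measurable : sigmaNxi `<=` measurable.
Proof.
move=> _ [E1 [E2 [/sigma_genN_measurable m1 /sigma_genxi_measurable m2 ->]]].
exact: measurableI.
Qed.

Lemma sigmaNxi_arrived n t : <<s sigmaNxi >> [set w | T n w <= t].
Proof.
apply: sub_sigma_algebra; exists [set w | T n w <= t], setT; split.
- exact: sigma_gen_arrived.
- exact: sigma_gen_setT.
- by rewrite setIT.
Qed.

Lemma sigma_gen_gauge i B : measurable B -> sigma_gen setT X (gauge i @^-1` B).
Proof.
move=> mB; have := @measurable_radial_sup _ _ A A_ruin _
  (g_sigma_algebraType (\bigcup_(i in setT) preimage_set_system setT (X i) measurable))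
  (X i) _ (X_ge0 i).
move=> h; have := h (@measurable_gen_family _ Omega _ _ _ setT (fun i => X i) i I).
by move=> /(_ measurableT B mB); rewrite setTI.
Qed.

Lemma measurable_xi_arrival i :
  measurable_fun setT ((fun w => xi (T i w) w) : g_sigma_algebraType sigmaNxi -> R).
Proof.
apply: (@measurable_sample _ (g_sigma_algebraType sigmaNxi) _
  (fun w => T i w) (fun s w => xi s w)).
- apply: measurable_fun_set_le => t; exact: sigmaNxi_arrived.
- by move=> w; exact: (arrival_time_ge0 N_renewal).
- move=> s s0; apply: measurable_gen => B mB; apply: sub_sigma_algebra.
  exists setT, (xi s @^-1` B); split; [exact: sigma_gen_setT| |by rewrite setTI].
  by apply: sigma_gen_preimage => //=; rewrite in_itv/= s0.
- by move=> w t t0; case: (xi_cadlag w) => + _; exact.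
Qed.

Variable S3 : set_system Omega.
Hypothesis S3T : S3 setT.
Hypothesis indep : independent_families P
  [:: sigma_gen setT X; sigma_gen `[0, +oo[ N; sigma_gen `[0, +oo[ xi; S3].

Lemma indep_prod E0 E1 E2 : sigma_gen setT X E0 -> sigma_gen `[0, +oo[ N E1 ->
  sigma_gen `[0, +oo[ xi E2 ->
  P (E0 `&` (E1 `&` E2)) = (P E0 * (P E1 * P E2))%E.
Proof.
apply: (indep_of_families4 _ S3T indep); split.
- exact: sigma_genX_measurable.
- exact: sigma_genN_measurable.
- exact: sigma_genxi_measurable.
Qed.

Lemma indep_N_xi : indep_classes P (sigma_gen `[0, +oo[ N) (sigma_gen `[0, +oo[ xi).
Proof.
move=> E1 E2 S1 S2; have := indep_prod (@sigma_gen_setT _ _ _ _ _ setT (fun i => X i)) S1 S2.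
by rewrite setTI probability_setT mul1e.
Qed.

Lemma indep_X_Nxi : indep_classes P (sigma_gen setT X) <<s sigmaNxi >>.
Proof.
apply: indep_classes_sigma.
- exact: sigma_genX_measurable.
- exact: sigmaNxi_measurable.
- by apply: setI_class_closed; exact: sigma_gen_setI.
- move=> E0 _ S0 [E1 [E2 [S1 S2 ->]]].
  by rewrite indep_prod// indep_N_xi.
Qed.

Variables C1 C2 : R.
Hypothesis C1_ge0 : 0 <= C1.
Hypothesis C12 : - C1 <= C2.

(** Truncation to the almost sure range changes no probability up to the horizon and
makes the bounds on the discount factors hold everywhere. *)
Definition log_price_at i w := clamp (- C1) C2 (xi (T i.+1 w) w).

Lemma log_price_bounds i w : - C1 <= log_price_at i w <= C2.
Proof. exact: clamp_bounds. Qed.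

Lemma measurable_log_price i :
  measurable_fun setT (log_price_at i : g_sigma_algebraType sigmaNxi -> R).
Proof. by apply: measurable_clamp; exact: measurable_xi_arrival. Qed.

Local Open Scope ereal_scope.

(** The integrand of the renewal integral. [Num.max 0 s] extends it to all real [s], on
which Stieltjes measures live, although the process is only controlled for
[0 <= s]. *)
Definition mean_tail (x s : R) : \bar R :=
  \int[P]_w (gauge_tail (x * expR (clamp (- C1) C2 (xi (Num.max 0%R s) w))))%:E.

Local Notation Gxi := (\bigcup_(s in `[0%R, +oo[) preimage_set_system setT (xi s) measurable).

Let frozen (x t : R) (z : measurableTypeR R * g_sigma_algebraType Gxi) : \bar R :=
  (\1_(`[0%R, t]%classic : set R) z.1 *
   gauge_tail (x * expR (clamp (- C1) C2 (xi (Num.max 0%R z.1) z.2))))%:E.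

Let measurable_gauge_tail : measurable_fun setT gauge_tail.
Proof. by apply: nonincreasing_measurable => // x y; exact: gauge_tail_noninc. Qed.

Let measurable_frozen x t : measurable_fun setT (frozen x t).
Proof.
have m1 : measurable_fun setT
    (fun z : measurableTypeR R * g_sigma_algebraType Gxi => z.1 : R).
  exact: (@measurable_fst _ _ (measurableTypeR R) (g_sigma_algebraType Gxi)).
have m2 := @measurable_snd _ _ (measurableTypeR R) (g_sigma_algebraType Gxi).
have mxi := @measurable_sample _ (measurableTypeR R * g_sigma_algebraType Gxi)%type R
  (fun z => Num.max 0%R (z.1 : R)) (fun s z => xi s z.2).
apply/measurable_EFinP; apply: measurable_funM.
  have mI : measurable_fun setT (\1_(`[0%R, t]%classic : set R) : R -> R).
    exact: measurable_indic.
  exact: (measurableT_comp mI m1).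
apply: measurableT_comp => //; apply: measurable_funM => //.
apply: measurableT_comp => //; apply: measurable_clamp; apply: mxi.
- exact: measurable_maxr.
- by move=> z; rewrite le_max lexx.
- move=> s s0; apply: measurableT_comp => //.
  by apply: (measurable_gen_family (Z := fun s => xi s)) => //=; rewrite in_itv/= s0.
- by move=> z s s0; case: (xi_cadlag z.2) => + _; exact.
Qed.

Let frozen_ge0 x t z : 0 <= frozen x t z.
Proof. by rewrite lee_fin mulr_ge0// ltW// gauge_tail_gt0. Qed.

Let mGxi : Gxi `<=` measurable.
Proof. by move=> E GE; apply: sigma_genxi_measurable; exact: sub_sigma_algebra. Qed.

Let integral_frozen x t s : \int[P]_w frozen x t (s, w) =
  (\1_(`[0%R, t]%classic : set R) s)%:E * mean_tail x s.
Proof.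
rewrite /mean_tail -ge0_integralZl//.
- apply/measurable_EFinP; apply: measurableT_comp => //; apply: measurable_funM => //.
  by apply: measurableT_comp => //; exact: measurable_clamp.
- by move=> w _; rewrite lee_fin ltW// gauge_tail_gt0.
Qed.

Lemma measurable_mean_tail x t :
  measurable_fun (`[0%R, t]%classic : set (measurableTypeR R)) (mean_tail x).
Proof.
have := measurable_frozen1 P mGxi (measurable_frozen x t) (frozen_ge0 x t).
move=> h; apply: (@eq_measurable_fun _ _ _ _ _ (fun s => \int[P]_w frozen x t (s, w))).
  by move=> s sD; rewrite integral_frozen indicE sD mul1e.
exact: measurable_funTS.
Qed.

(** The claim is integrated out first, then the prices, given the arrival time. *)
Lemma exceeds_mean_tail i x t : (0 <= t)%R ->
  P (exceeds tau gauge log_price_at i x t) =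
  \int[distribution P (arrival_rv tau i.+1)]_(s in `[0%R, t]) mean_tail x s.
Proof.
move=> t0.
rewrite (exceedsE gauge_law sigmaNxi_measurable sigma_gen_gauge indep_X_Nxi
  sigmaNxi_arrived measurable_log_price).
have iT : indep_classes P
    (preimage_set_system setT (arrival_rv tau i.+1) measurable) <<s Gxi >>.
  move=> E C [B mB <-] SC; apply: indep_N_xi => //; rewrite setTI.
  have mT : measurable_fun setT ((fun w => T i.+1 w) : g_sigma_algebraType
      (\bigcup_(s in `[0%R, +oo[) preimage_set_system setT (N s) measurable) -> R).
    by apply: measurable_fun_set_le => s; exact: sigma_gen_arrived.
  by have := mT measurableT B mB; rewrite setTI.
transitivity (\int[P]_w frozen x t (arrival_rv tau i.+1 w, w)).
  apply: eq_integral => w _; rewrite /frozen /=.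
  have T0 : (0 <= T i.+1 w)%R := arrival_time_ge0 N_renewal _ _.
  rewrite (max_idPr T0) /log_price_at !indicE; congr ((nat_of_bool _)%:R * _)%:E.
  apply/idP/idP => /set_mem /= h; apply/mem_set => /=; first by rewrite in_itv/= T0.
  by move: h; rewrite in_itv/= => /andP[].
rewrite (freezing1 mGxi iT (measurable_frozen x t) (frozen_ge0 x t)).
rewrite [RHS]integral_mkcond; apply: eq_integral => s _.
rewrite integral_frozen indicE patchE; case: ifPn => _; first by rewrite mul1e.
by rewrite mul0e.
Qed.

Local Close Scope ereal_scope.

Lemma measurable_claim_sum (a : nat -> Omega -> R) (x t : R) : 0 < x ->
  (forall i, measurable_fun setT (a i)) ->
  measurable [set w | dilate x A (\sum_(i < N t w) a i w *: (X i w : 'rV[R]_d))].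
Proof.
move=> x0 ma.
rewrite (_ : [set _ | _] = \bigcup_m ((N t @^-1` [set m]) `&`
    [set w | dilate x A (\sum_(i < m) a i w *: (X i w : 'rV[R]_d))])).
  apply: bigcupT_measurable => m; apply: measurableI.
    by rewrite -[X in measurable X]setTI; exact: measurable_funP.
  apply: measurable_scaled_dilate => // j.
  under eq_fun do rewrite summxE.
  apply: measurable_sum => i; under eq_fun do rewrite mxE.
  apply: measurable_funM => //.
  by apply: (measurableT_comp (measurable_coord j)).
by apply/seteqP; split => [w h|w [m _ [/= <-]]//]; exists (N t w).
Qed.

Definition ruin_event (x t : R) : set Omega :=
  [set w | dilate x A (\sum_(i < N t w) expR (- log_price_at i w) *: (X i w : 'rV[R]_d))].

Lemma measurable_expN (f : Omega -> R) : measurable_fun setT f ->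
  measurable_fun setT (fun w => expR (- f w)).
Proof. by move=> mf; apply: measurableT_comp => //; exact: measurableT_comp. Qed.

Lemma measurable_xi_at i : measurable_fun setT (fun w => xi (T i w) w).
Proof. exact: (g_measurable_fun sigmaNxi_measurable (measurable_xi_arrival i)). Qed.

Lemma measurable_ruin_event x t : 0 < x -> measurable (ruin_event x t).
Proof.
move=> x0; apply: (measurable_claim_sum (a := fun i w => expR (- log_price_at i w))) => // i.
by apply: measurable_expN; apply: measurable_clamp; exact: measurable_xi_at.
Qed.

Let discounted_ge0 w i : nonneg_vec (expR (- log_price_at i w) *: (X i w : 'rV[R]_d)).
Proof. by apply: nonneg_vecZ => //; exact: expR_ge0. Qed.

Lemma exceeds_ruin x t i : 0 < x -> 0 <= t ->
  exceeds tau gauge log_price_at i x t `<=` ruin_event x t.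
Proof.
move=> x0 t0 w [/= Tt xY].
have iN : (i < N t w)%N by rewrite (count_geE N_renewal).
apply/(dilate_radial A_ruin (nonneg_vec_sum _ (discounted_ge0 w)) x0).
apply: lt_le_trans (radial_sup_le_sum A_ruin (discounted_ge0 w) iN).
apply/radial_sup_gtZ => //; first exact: expR_gt0.
by rewrite expRN invrK.
Qed.

Lemma ruin_total x t : 0 < x ->
  ruin_event x t `<=` [set w | x < discounted_total N gauge log_price_at t w].
Proof.
move=> x0 w /(dilate_radial A_ruin (nonneg_vec_sum _ (discounted_ge0 w)) x0) /= xr.
apply: (lt_le_trans xr); apply: (le_trans (radial_sup_sum A_ruin _ (discounted_ge0 w))).
by apply: ler_sum => i _; apply: radial_supZ_le => //; exact: expR_gt0.
Qed.

Variables (T0 : R) (Z : set Omega).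
Hypotheses (mZ : measurable Z) (PZ0 : P Z = 0%E).
Hypothesis xi_range : forall w, ~ Z w -> forall s, 0 <= s <= T0 -> - C1 <= xi s w <= C2.

Lemma ruin_probability x t : 0 < x -> 0 <= t <= T0 ->
  P [set w | dilate x A (discounted_claims X tau N xi t w)] = P (ruin_event x t).
Proof.
move=> x0 /andP[t0 tT]; apply: (eq_probability_ae mZ PZ0).
- apply: (measurable_claim_sum (a := fun i w => expR (- xi (T i.+1 w) w))) => // i.
  by apply: measurable_expN; exact: measurable_xi_at.
- exact: measurable_ruin_event.
- move=> w /xi_range bw; rewrite /ruin_event /= /discounted_claims.
  rewrite (eq_bigr (fun i : 'I_(N t w) =>
     expR (- log_price_at i w) *: (X i w : 'rV[R]_d)))// => i _.
  rewrite /log_price_at clamp_id// bw// (arrival_time_ge0 N_renewal)/=.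
  by rewrite (le_trans _ tT)// -(count_geE N_renewal).
Qed.

Variable X0 : {RV P >-> borel_rV R d}.
Hypothesis X0_law : has_law X0 F.
Hypothesis X0_indep : independent_families P
    [:: sigma_gen setT (fun _ : unit => X0); sigma_gen `[0, +oo[ xi].

Let measurable_gauge0 : measurable_fun setT (fun w => Num.max 0 (radial_sup A (X0 w))).
Proof. exact: measurable_radial_sup_max. Qed.

Let gauge0 : {RV P >-> R} := HB.pack (fun w => Num.max 0 (radial_sup A (X0 w)))
  (isMeasurableFun.Build _ _ _ _ _ measurable_gauge0).

Let gauge0_law y : 0 <= y -> P [set w | y < gauge0 w] = (gauge_tail y)%:E.
Proof.
move=> y0; rewrite /gauge_tail prK; last exact: measurable_set_lt.
rewrite law_radial_sup// -X0_law; last first.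
  by apply: measurable_open_rV; exact: open_radial_sup_gt.
congr (P _); apply/seteqP; split => w /=; rewrite lt_max; first by rewrite ltNge y0.
by move=> ->; rewrite orbT.
Qed.

Lemma X0_nonneg : P [set w | ~ nonneg_vec (X0 w : 'rV[R]_d)] = 0%E.
Proof.
have mO := @measurable_nonneg_vec R d.
have -> : P [set w | ~ nonneg_vec (X0 w : 'rV[R]_d)] = F (~` [set v | nonneg_vec v]).
  by rewrite -X0_law//; exact: measurableC.
rewrite -(X_law 0); last exact: measurableC.
rewrite /distribution /pushforward (_ : _ @^-1` _ = set0) ?measure0//.
by apply/seteqP; split => // w /=; have := X_ge0 0 w.
Qed.

(** The generic claim is nonnegative only almost surely, being known through its law. *)
Lemma mean_tail_generic x s : 0 < x -> 0 <= s <= T0 ->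
  P [set w | dilate x A (expR (- xi s w) *: (X0 w : 'rV[R]_d))] = mean_tail x s.
Proof.
move=> x0 /andP[s0 sT]; pose V w := x * expR (clamp (- C1) C2 (xi s w)).
have Vgt0 w : 0 < V w by rewrite mulr_gt0// expR_gt0.
have mxi : measurable_fun setT (xi s : g_sigma_algebraType Gxi -> R).
  by apply: (measurable_gen_family (Z := fun s => xi s)) => //=; rewrite in_itv/= s0.
have mV : measurable_fun setT (V : g_sigma_algebraType Gxi -> R).
  apply: measurable_funM => //; apply: measurableT_comp => //.
  exact: measurable_clamp.
have i0 : indep_classes P (preimage_set_system setT gauge0 measurable) <<s Gxi >>.
  have iX := indep_of_families2 _ sigma_genxi_measurable X0_indep.
  have {}iX : indep_classes P (sigma_gen setT (fun _ : unit => X0))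
      (sigma_gen `[0, +oo[ xi).
    by apply: iX; apply: sigma_gen_measurable => i _.
  move=> E C [B mB <-] SC; apply: iX => //.
  have := @measurable_radial_sup_max _ _ A A_ruin _ (g_sigma_algebraType
    (\bigcup_(i in setT) preimage_set_system setT ((fun _ : unit => X0) i) measurable)) X0.
  move=> h; have := h (@measurable_gen_family _ Omega _ _ _ setT (fun _ : unit => X0) tt I).
  by move=> /(_ measurableT B mB).
transitivity (P (setT `&` [set w | V w < gauge0 w])).
  have mN : measurable [set w | ~ nonneg_vec (X0 w : 'rV[R]_d)].
    have := @measurable_nonneg_vec R d => /measurableC mO.
    by have := measurable_funP X0 measurableT _ mO; rewrite setTI.
  apply: (@eq_probability_ae _ _ _ P (Z `|` [set w | ~ nonneg_vec (X0 w : 'rV[R]_d)])).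
  - exact: measurableU.
  - apply/eqP; rewrite eq_le measure_ge0 andbT.
    have : (P (Z `|` [set w | ~ nonneg_vec (X0 w : 'rV[R]_d)]) <=
        P Z + P [set w | ~ nonneg_vec (X0 w : 'rV[R]_d)])%E by exact: measureU2.
    by rewrite PZ0 X0_nonneg adde0.
  - apply: measurable_scaled_dilate => // i; under eq_fun do rewrite mxE.
    apply: measurable_funM; first exact: measurable_expN.
    by apply: (measurableT_comp (measurable_coord i)).
  - by rewrite setTI; apply: measurable_set_lt => //; exact: (g_measurable_fun mGxi mV).
  - move=> w /not_orP[/xi_range bw /contrapT X0w].
    rewrite setTI /= dilateZ ?expR_gt0// dilate_radial ?divr_gt0 ?expR_gt0//.
    rewrite lt_max ltNge (ltW (Vgt0 w)) /= /V clamp_id ?bw ?s0//.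
    by rewrite expRN invrK.
have GT : <<s Gxi >> setT by exact: (@measurableT _ (g_sigma_algebraType Gxi)).
rewrite (freezing_tail mGxi i0 mV GT) /mean_tail; apply: eq_integral => w _.
by rewrite indicT mul1e gauge0_law ?(ltW (Vgt0 w))// (max_idPr s0).
Qed.

Variable lambda : cumulative R R.
Hypothesis lambdaE : forall t : R, (lambda t)%:E = renewal_function N t.

Lemma integral_mean_tail x t : 0 < x -> 0 <= t <= T0 ->
  (\int[lebesgue_stieltjes_measure lambda]_(s in `[0%R, t])
     P [set w | dilate x A (expR (- xi s w) *: (X0 w : 'rV[R]_d))])%E =
  (\sum_(i <oo) P (exceeds tau gauge log_price_at i x t))%E.
Proof.
move=> x0 /andP[t0 tT].
transitivity (\int[lebesgue_stieltjes_measure lambda]_(s in `[0%R, t]) mean_tail x s)%E.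
  apply: eq_integral => s /set_mem /=; rewrite in_itv/= => /andP[s0 st].
  by rewrite mean_tail_generic// s0 (le_trans st).
rewrite (integral_renewal N_renewal lambdaE).
- by apply: eq_eseriesr => i _; rewrite exceeds_mean_tail.
- exact: measurable_itv.
- exact: measurable_mean_tail.
- by move=> s _; apply: integral_ge0 => w _; rewrite lee_fin ltW// gauge_tail_gt0.
Qed.

Lemma sum_exceeds_fin x t :
  (\sum_(i <oo) P (exceeds tau gauge log_price_at i x t))%E \is a fin_num.
Proof.
have h : ((\sum_(i <oo) P (exceeds tau gauge log_price_at i x t)) <= (lambda t)%:E)%E.
  rewrite lambdaE (renewal_functionE N_renewal); apply: lee_nneseries => [i _ _|i _].
    exact: measure_ge0.
  apply: le_measure; rewrite ?inE; [|exact: measurable_arrived|by move=> w []].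
  exact: (measurable_exceeds _ _ sigmaNxi_measurable measurable_log_price).
rewrite ge0_fin_numE ?(le_lt_trans h) ?ltry//.
by apply: nneseries_ge0 => i _ _; exact: measure_ge0.
Qed.

(** Later arrivals are no likelier than the first one, so the whole sum vanishes with
its probability. *)
Lemma first_arrival_gt0 t : 0 < lambda t -> 0 < pr P [set w | T 1 w <= t].
Proof.
move=> l0; rewrite lt_neqAle pr_ge0 ?andbT; last exact: measurable_arrived.
apply/negP => /eqP p0; move: l0; rewrite -lte_fin lambdaE (renewal_functionE N_renewal).
rewrite eseries0 ?ltxx// => i _ _; apply/eqP; rewrite eq_le measure_ge0 andbT.
rewrite -prK; last exact: measurable_arrived.
rewrite lee_fin p0; apply: pr_le; [exact: measurable_arrived..|].
by move=> w /=; apply: le_trans; exact: (arrival_time_le N_renewal).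
Qed.

Lemma ruin_equivalence (e : R) : 0 < e -> exists x0, forall x t, x0 <= x ->
  0 < t <= T0 -> 0 < lambda t ->
  `|fine (P [set w | dilate x A (discounted_claims X tau N xi t w)]) /
    fine (\int[lebesgue_stieltjes_measure lambda]_(s in `[0%R, t])
      P [set w | dilate x A (expR (- xi s w) *: (X0 w : 'rV[R]_d))])%E - 1| <= e.
Proof.
move=> e0; have [q poly] := gauge_tail_poly.
have [x0 h] := single_big_claim N_renewal gauge_ge0 gauge_law gauge_tail_gt0 poly
  gauge_tail_long gauge_tai sigmaNxi_measurable (@sigma_gen_setI _ _ _ _ _ _ _)
  sigma_gen_gauge indep_X_Nxi sigmaNxi_arrived C1_ge0 log_price_bounds
  measurable_log_price T0 e0.
exists (Num.max 1 x0) => x t; rewrite ge_max => /andP[x1 x0x] /andP[t0 tT] l0.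
have xgt0 : 0 < x by rewrite (lt_le_trans ltr01).
have t0T : 0 <= t <= T0 by rewrite ltW.
rewrite integral_mean_tail// ruin_probability//.
apply: (h x t _ (ruin_event x t) x0x t0T (first_arrival_gt0 l0) _ _ _ _).2.
- exact: measurable_ruin_event.
- by move=> i; apply: exceeds_ruin => //; exact: ltW.
- exact: ruin_total.
- by rewrite fineK// sum_exceeds_fin.
Qed.

End model.

Theorem theorem3p1 (R : realType) (d : nat) (d_gt0 : (0 < d)%N)
  (disp : measure_display) (Omega : measurableType disp)
  (P : probability Omega R)
  (A : set 'rV[R]_d) (A_ruin : ruin_family A)
  (* claim vectors, with values in [0, +oo[^d \ {0} *)
  (X : nat -> {RV P >-> borel_rV R d})
  (X_ge0 : forall i w, nonneg_vec (X i w : 'rV[R]_d))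
  (X_neq0 : forall i w, (X i w : 'rV[R]_d) <> 0)
  (* renewal counting process and its (finite) renewal function *)
  (tau : nat -> {RV P >-> R}) (N : R -> {RV P >-> nat})
  (N_renewal : renewal_process tau N)
  (lambda : cumulative R R)
  (lambdaE : forall t : R, (lambda t)%:E = renewal_function N t)
  (* log-price process of the portfolio *)
  (xi : R -> {RV P >-> R})
  (xi_cadlag : forall w, cadlag (fun t => xi t w))
  (xi0 : forall w, xi 0 w = 0)
  (* premium densities *)
  (c : R -> {RV P >-> borel_rV R d}) (M : 'I_d -> R)
  (M_ge0 : forall i, 0 <= M i)
  (c_bounded : forall (t : R) w i, 0 <= t ->
    0 <= (c t w : 'rV[R]_d) ord0 i <= M i)
  (* (i) *)
  (xi_bounded : forall T : R, 0 < T -> exists C1 C2 : R,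
    [/\ 0 <= C1 <= C2,
        {ae P, forall w,
          ((- C1)%:E <= ereal_inf [set (xi t w)%:E | t in `[0%R, T]])%E} &
        {ae P, forall w,
          (ereal_sup [set (xi t w)%:E | t in `[0%R, T]] <= C2%:E)%E}])
  (* (ii) *)
  (F : probability (borel_rV R d) R)
  (X_law : forall i, has_law (X i) F)
  (F_class : in_class_DL_along F A)
  (X_tai : forall i j, i <> j ->
    tail_asymp_indep P (fun w => radial_sup A (X i w))
                       (fun w => radial_sup A (X j w)))
  (* (iii) *)
  (indep : independent_families P
    [:: sigma_gen setT X; sigma_gen `[0, +oo[ N;
        sigma_gen `[0, +oo[ xi; sigma_gen `[0, +oo[ c])
  (* generic claim vector *)
  (X0 : {RV P >-> borel_rV R d})
  (X0_law : has_law X0 F)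
  (X0_indep : independent_families P
    [:: sigma_gen setT (fun _ : unit => X0); sigma_gen `[0, +oo[ xi])
  (T : R) (T_gt0 : 0 < T) :
  uniformly_equivalent (`]0, T] `&` [set t | 0 < lambda t])
    (fun x t =>
       fine (P [set w | dilate x A (discounted_claims X tau N xi t w)]))
    (fun x t =>
       fine (\int[lebesgue_stieltjes_measure lambda]_(s in `[0%R, t])
         P [set w | dilate x A (expR (- xi s w) *: (X0 w : 'rV[R]_d))])%E).
Proof.
have [C1 [C2 [/andP[C1_ge0 C12] lo up]]] := xi_bounded T T_gt0.
have C12' : - C1 <= C2 by rewrite (le_trans _ C12)// (le_trans _ C1_ge0)// oppr_le0.
have [Z1 [mZ1 PZ1 sub1]] := lo; have [Z2 [mZ2 PZ2 sub2]] := up.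
have mZ : measurable (Z1 `|` Z2) by exact: measurableU.
have PZ : P (Z1 `|` Z2) = 0%E.
  apply/eqP; rewrite eq_le measure_ge0 andbT.
  have : (P (Z1 `|` Z2) <= P Z1 + P Z2)%E by exact: measureU2.
  by rewrite PZ1 PZ2 adde0.
have range w : ~ (Z1 `|` Z2) w -> forall s, 0 <= s <= T -> - C1 <= xi s w <= C2.
  move=> /not_orP[nZ1 nZ2] s sT.
  have sI : [set (xi t w)%:E | t in `[0%R, T]] (xi s w)%:E.
    by exists s => //=; rewrite in_itv.
  apply/andP; split; rewrite -lee_fin.
    apply: le_trans (ereal_inf_lbound sI).
    by apply: contrapT => h; apply: nZ1; exact: sub1.
  apply: le_trans (ereal_sup_ubound sI) _.
  by apply: contrapT => h; apply: nZ2; exact: sub2.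
apply: cvg_ereal0 => [x|e e0]; first by apply: ereal_sup_ubound; left.
have cT : sigma_gen `[0, +oo[ c setT by exact: sigma_gen_setT.
have [x0 h] := ruin_equivalence A_ruin F_class X_ge0 X_law X_tai N_renewal
  xi_cadlag cT indep C1_ge0 C12' mZ PZ range X0_law X0_indep
  lambdaE e0.
exists x0 => x x0x; apply: ge_ereal_sup => _ [->|[t [/= tT l0] <-]].
  by rewrite lee_fin ltW.
by rewrite lee_fin; apply: h => //; move: tT; rewrite in_itv.
Qed.
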